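(* Let $h\in L^\infty(0,T)$ be positive (and known) with $h\ge c_h$ for some constant $c_h>0$, let $f,g\in L^2(D)$ with $g\ne0$, and suppose $g\in H^2(D)$. Let $u$ be the mild solution of the stochastic fractional diffusion equation with source terms $f,g,h$, put $u_n(T)=\langle u(\cdot,T),\phi_n\rangle_{L^2(D)}$, and let $N_0\in\mathbb{N}^+$ be an index such that $\langle g,\phi_{N_0}\rangle_{L^2(D)}\ne0$. Then the quantities $$\left\{\mathbb{E}[u_n(T)],\ \mathbb{V}(u_{N_0}(T)),\ \mathrm{Cov}(u_{N_0}(T),u_n(T))\;:\;n\in\mathbb{N}^+\right\}$$ determine $f$ and $|g|$ uniquely. That is, if $\tilde f\in L^2(D)$ and $0\neq\tilde g\in H^2(D)$ are such that the mild solution $\tilde u$ with source terms $\tilde f,\tilde g$ and the same $h$ satisfies, with $\tilde u_n(T)=\langle\tilde u(\cdot,T),\phi_n\rangle_{L^2(D)}$, the equalities $\mathbb{E}[\tilde u_n(T)]=\mathbb{E}[u_n(T)]$, $\mathbb{V}(\tilde u_{N_0}(T))=\mathbb{V}(u_{N_0}(T))$ and $\mathrm{Cov}(\tilde u_{N_0}(T),\tilde u_n(T))=\mathrm{Cov}(u_{N_0}(T),u_n(T))$ for all $n\in\mathbb{N}^+$, then $\tilde f=f$ and $|\tilde g|=|g|$ almost everywhere in $D$.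
   Context: Let $\alpha\in(1/2,1)$, $T>0$, and let $D\subset\mathbb{R}^n$ be open and bounded. Let $$\mathcal{A}u=-\sum_{i,j=1}^n a^{ij}(x)u_{x_ix_j}+\sum_{i=1}^n b^i(x)u_{x_i}+c(x)u,\qquad a^{ij},b^i,c\in C^\infty(\mathbb{R}^n),$$ be symmetric, elliptic and positive definite, considered with zero Dirichlet boundary condition on $\partial D$. Its eigensystem is $\{(\lambda_n,\phi_n):n\in\mathbb{N}^+\}$, where $0<\lambda_1\le\lambda_2\le\cdots$ and $\{\phi_n\}\subset H^2(D)\cap H^1_0(D)$ is an orthonormal basis of $L^2(D)$. The Mittag--Leffler function is $E_{\alpha,\beta}(z)=\sum_{k=0}^\infty \frac{z^k}{\Gamma(k\alpha+\beta)}$. Let $\mathbb{W}$ be a standard (one-dimensional) Wiener process on a probability space $(\Omega,\mathcal{F},\mathbb{P})$ with expectation $\mathbb{E}$. For random variables $X,Y$: $\mathbb{V}(X)=\mathbb{E}(X-\mathbb{E}X)^2$ and $\mathrm{Cov}(X,Y)=\mathbb{E}(X-\mathbb{E}X)(Y-\mathbb{E}Y)$. The equation is $\partial_t^\alpha u+\mathcal{A}u=f(x)h(t)+g(x)\dot{\mathbb{W}}(t)$ in $D\times(0,T]$, with $u=0$ on $\partial D\times(0,T]$ and $u(\cdot,0)=0$ in $D$, where $\partial_t^\alpha$ is the Djrbashyan--Caputo fractional derivative. Its mild solution is by definition the stochastic process $$u(\cdot,t)=\sum_{n=1}^\infty\big(I_{n,1}(t)+I_{n,2}(t)\big)\phi_n(\cdot),\quad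 t\in[0,T],$$ $$I_{n,1}(t)=f_n\int_0^t(t-\tau)^{\alpha-1}E_{\alpha,\alpha}(-\lambda_n(t-\tau)^\alpha)h(\tau)\,d\tau,\quad I_{n,2}(t)=g_n\int_0^t(t-\tau)^{\alpha-1}E_{\alpha,\alpha}(-\lambda_n(t-\tau)^\alpha)\,d\mathbb{W}(\tau),$$ with $f_n=\langle f,\phi_n\rangle_{L^2(D)}$ and $g_n=\langle g,\phi_n\rangle_{L^2(D)}$. *)

(* Defs.v *)
From HB Require Import structures.
From mathcomp Require Import all_boot all_order all_algebra.
From mathcomp Require Import all_classical all_reals all_analysis.

Set Implicit Arguments.
Unset Strict Implicit.
Unset Printing Implicit Defensive.

Import Order.TTheory GRing.Theory Num.Theory.
Import numFieldNormedType.Exports.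

Local Open Scope classical_set_scope.
Local Open Scope ring_scope.

Definition measure_rV_display : measure_display.
Proof. exact: default_measure_display. Qed.

(* The sigma-algebra generated by the coordinates, that is, the Borel sets of
   R^n. *)
Section measurable_rV.
Context {R : realType}.
Variable n : nat.

Let coors : 'I_n -> 'rV[R]_n -> R := fun i x => x ord0 i.

Let rV_set0 : g_sigma_preimage coors set0.
Proof. exact: sigma_algebra0. Qed.

Let rV_setC A : g_sigma_preimage coors A -> g_sigma_preimage coors (~` A).
Proof. exact: sigma_algebraC. Qed.

Let rV_bigcup (F : _^nat) : (forall i, g_sigma_preimage coors (F i)) ->
  g_sigma_preimage coors (\bigcup_i (F i)).
Proof. exact: sigma_algebra_bigcup. Qed.

HB.instance Definition _ := @isMeasurable.Build measure_rV_display
    'rV[R]_n (g_sigma_preimage coors) rV_set0 rV_setC rV_bigcup.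

End measurable_rV.

Lemma measurable_coord (R : realType) n (i : 'I_n) :
  measurable_fun [set: 'rV[R]_n] (fun x : 'rV[R]_n => x ord0 i).
Proof.
move=> _ Y mY; rewrite setTI; apply: sub_sigma_algebra => /=.
rewrite -bigcup_seq/=; exists i => /=; first by rewrite mem_index_enum.
by exists Y => //; rewrite setTI.
Qed.

Lemma measurable_fun_coordP d (T : measurableType d) (R : realType) n
    (f : T -> 'rV[R]_n) :
  (forall i, measurable_fun [set: T] (fun x => f x ord0 i)) ->
  measurable_fun [set: T] f.
Proof.
move=> mf.
pose coors (i : 'I_n) (x : 'rV[R]_n) : R := x ord0 i.
suff: preimage_set_system [set: T] f (g_sigma_preimage coors) `<=` measurable.
  by move=> prefS _ A mA; apply: prefS; exists A.
rewrite -g_sigma_preimage_comp.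
apply: smallest_sub; first exact: sigma_algebra_measurable.
rewrite -bigcup_seq => A [i _] [B mB <-].
exact: (mf i).
Qed.

Definition rV_cons (R : realType) n (p : measurableTypeR R * 'rV[R]_n) :
    'rV[R]_n.+1 :=
  \row_i oapp (p.2 ord0) p.1 (unlift ord0 i).

Lemma measurable_rV_cons (R : realType) n :
  measurable_fun [set: measurableTypeR R * 'rV[R]_n] (@rV_cons R n).
Proof.
apply: measurable_fun_coordP => i.
under eq_fun do rewrite mxE.
case: (unliftP ord0 i) => [j|] _ /=; last exact: measurable_fst.
exact: (measurableT_comp (@measurable_coord R n j) measurable_snd).
Qed.

Definition rV_uncons (R : realType) n (x : 'rV[R]_n.+1) :
    measurableTypeR R * 'rV[R]_n :=
  (x ord0 ord0, \row_i x ord0 (lift ord0 i)).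

Lemma rV_consK (R : realType) n : cancel (@rV_cons R n) (@rV_uncons R n).
Proof.
move=> [x v]; rewrite /rV_uncons mxE unlift_none/=; congr pair.
by apply/rowP => i; rewrite !mxE liftK.
Qed.

Lemma measurable_rV_uncons (R : realType) n :
  measurable_fun [set: 'rV[R]_n.+1] (@rV_uncons R n).
Proof.
apply/measurable_fun_pairP; split; first exact: measurable_coord.
apply: measurable_fun_coordP => i /=.
under eq_fun do rewrite /= mxE.
exact: measurable_coord.
Qed.

Section lebesgue_rV_step.
Context {R : realType} (n : nat).
Variable m : {sigma_finite_measure set 'rV[R]_n -> \bar R}.

Definition lebesgue_rV_step : set 'rV[R]_n.+1 -> \bar R :=
  pushforward (@lebesgue_measure R \x m)%E (@rV_cons R n).

Let mcons := @measurable_rV_cons R n.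

Let step0 : lebesgue_rV_step set0 = 0%E.
Proof. exact: measure0. Qed.

Let step_ge0 A : (0 <= lebesgue_rV_step A)%E.
Proof. exact: measure_ge0. Qed.

Let step_sigma_additive : semi_sigma_additive lebesgue_rV_step.
Proof. exact: measure_semi_sigma_additive. Qed.

HB.instance Definition _ := isMeasure.Build _ _ _ lebesgue_rV_step
  step0 step_ge0 step_sigma_additive.

Let step_sigma_finite : sigma_finite setT lebesgue_rV_step.
Proof.
have [F FT Foo] := sigma_finiteT m.
have [G GT Goo] := sigma_finiteT (@lebesgue_measure R).
pose FG (p : nat * nat) := @rV_uncons R n @^-1` (G p.1 `*` F p.2).
have FGT : \bigcup_p FG p = setT.
  rewrite -subTset => x _.
  have : [set: R] (rV_uncons x).1 by [].
  have : [set: 'rV[R]_n] (rV_uncons x).2 by [].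
  by rewrite FT GT => -[j _ Fj] [i _ Gi]; exists (i, j).
have mFG p : measurable (FG p).
  rewrite -[X in measurable X]setTI; apply: measurable_rV_uncons => //.
  by apply: measurableX; [exact: (Goo _).1|exact: (Foo _).1].
exists (fun k => if unpickle k is Some p then FG p else set0).
  apply/esym; rewrite -subTset -FGT => x [p _ FGx].
  by exists (pickle p) => //; rewrite pickleK.
move=> k; case: unpickle => [p|]; last by rewrite measure0.
split => //; rewrite /lebesgue_rV_step /pushforward /FG -comp_preimage.
rewrite (_ : _ \o _ = id); last by apply/funext => x; exact: rV_consK.
have [mG Gp] := Goo p.1; have [mF Fp] := Foo p.2.
by rewrite preimage_id product_measure1E// lte_mul_pinfty// ge0_fin_numE.
Qed.

HB.instance Definition _ := Measure_isSigmaFinite.Build _ _ _ lebesgue_rV_step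
  step_sigma_finite.

End lebesgue_rV_step.

(* R^(n+1) carries the image of the product of the Lebesgue measures of R and
   R^n; see lebesgue_rV_box. *)
Fixpoint lebesgue_rV (R : realType) (n : nat) :
    {sigma_finite_measure set 'rV[R]_n -> \bar R} :=
  match n with
  | 0 => \d_(0 : 'rV[R]_0)
  | k.+1 => lebesgue_rV_step (lebesgue_rV R k)
  end.
Arguments lebesgue_rV {R} n.

Lemma lebesgue_rV_box (R : realType) n (A : 'I_n -> set R) :
  (forall i, measurable (A i)) ->
  lebesgue_rV n [set x : 'rV[R]_n | forall i, A i (x ord0 i)] =
  (\prod_(i < n) lebesgue_measure (A i))%E.
Proof.
elim: n A => [|n ih] A mA.
  rewrite big_ord0 /= diracE mem_set//= => i; by case: i.
rewrite big_ord_recl -(ih (fun i => A (lift ord0 i)))//= /lebesgue_rV_step.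
rewrite /pushforward -(@product_measure1E _ _ _ _ R lebesgue_measure)//.
- congr (_ _); apply/seteqP; split => -[x v]/=.
    move=> H; split; first by have := H ord0; rewrite mxE unlift_none.
    by move=> i; have := H (lift ord0 i); rewrite mxE liftK.
  by move=> [Ax Av] i; rewrite mxE; case: unliftP => [j|] ->//=.
- exact: mA.
- rewrite [X in measurable X](_ : _ = \big[setI/setT]_(i < n)
    ((fun x : 'rV[R]_n => x ord0 i) @^-1` A (lift ord0 i))).
    apply: bigsetI_measurable => i _; rewrite -[X in measurable X]setTI.
    by apply: measurable_coord => //; exact: mA.
  by rewrite -bigcap_seq; apply/seteqP; split => x /= H i *; apply: H;
    rewrite /= ?mem_index_enum.
Qed.

(* Functions are total; only their values on D matter. *)

Section L2.
Context d (X : measurableType d) (R : realType).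
Variables (mu : {measure set X -> \bar R}) (D : set X).

Definition L2 (f : X -> R) : Prop := f \_ D \in Lfun mu 2%:E.

Definition L2_cvg (F : nat -> X -> R) (f : X -> R) : Prop :=
  ('N[mu]_(2%:E) [EFin \o ((F k \- f)%R \_ D)])%E @[k --> \oo] --> 0%E.

Definition inner (f g : X -> R) : R := \int[mu]_(x in D) (f x * g x).

End L2.

(* A sequence of indices [:: i1; ...; ik] stands for the differential operator
   d_i1 ... d_ik. *)

Section sobolev.
Context {R : realType} {n : nat}.
Implicit Types (u v w : 'rV[R]_n -> R) (s : seq 'I_n).

Definition partials s u : 'rV[R]_n -> R :=
  foldr (fun i v => 'D_(delta_mx ord0 i) v) u s.

Definition smooth u : Prop := forall s,
  continuous (partials s u) /\
  forall i x, derivable (partials s u) x (delta_mx ord0 i).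

Variable D : set 'rV[R]_n.

Definition test_function u : Prop :=
  let supp := closure [set x | u x != 0] in
  [/\ smooth u, compact supp & supp `<=` D].

Notation L2D := (L2 (lebesgue_rV n) D).
Notation L2D_cvg := (L2_cvg (lebesgue_rV n) D).
Notation innerD := (inner (lebesgue_rV n) D).

Definition weak_derivative s u v : Prop := forall psi, test_function psi ->
  innerD u (partials s psi) = (-1) ^+ size s * innerD v psi.

(* The space H^k(D). *)
Definition sobolev (k : nat) u : Prop := L2D u /\
  forall s, (size s <= k)%N -> exists2 v, L2D v & weak_derivative s u v.

(* H^1_0(D): the closure of the test functions for the norm of H^1(D). *)
Definition sobolev10 u : Prop := sobolev 1 u /\
  exists psi : nat -> 'rV[R]_n -> R,
    [/\ forall k, test_function (psi k), L2D_cvg psi u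
      & forall i v, L2D v -> weak_derivative [:: i] u v ->
          L2D_cvg (fun k => partials [:: i] (psi k)) v].

Variables (a : 'I_n -> 'I_n -> 'rV[R]_n -> R) (b : 'I_n -> 'rV[R]_n -> R)
  (c : 'rV[R]_n -> R).

(* w = A u almost everywhere in D, for the operator
   A u = - sum_ij a^ij u_xixj + sum_i b^i u_xi + c u with weak derivatives. *)
Definition operator u w : Prop :=
  exists (u1 : 'I_n -> 'rV[R]_n -> R) (u2 : 'I_n -> 'I_n -> 'rV[R]_n -> R),
  [/\ forall i, L2D (u1 i) /\ weak_derivative [:: i] u (u1 i),
      forall i j, L2D (u2 i j) /\ weak_derivative [:: i; j] u (u2 i j)
    & w = (fun x => - (\sum_i \sum_j a i j x * u2 i j x)
             + \sum_i b i x * u1 i x + c x * u x)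
        %[ae lebesgue_rV n in D]].

(* The zero Dirichlet condition is encoded in the domain of A. *)
Definition dirichlet_domain u : Prop := sobolev 2 u /\ sobolev10 u.

Definition elliptic : Prop := exists2 theta : R, 0 < theta &
  forall x (xi : 'rV[R]_n), D x ->
    theta * \sum_i xi ord0 i ^+ 2
      <= \sum_i \sum_j a i j x * xi ord0 i * xi ord0 j.

Definition symmetric_operator : Prop := forall u v Au Av,
  dirichlet_domain u -> dirichlet_domain v ->
  operator u Au -> operator v Av -> innerD Au v = innerD u Av.

Definition positive_definite_operator : Prop := forall u Au,
  dirichlet_domain u -> operator u Au ->
  ~ u = cst 0 %[ae lebesgue_rV n in D] -> 0 < innerD Au u.

Definition admissible_operator : Prop :=
  [/\ forall i j, smooth (a i j), forall i, smooth (b i) & smooth c] /\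
  [/\ symmetric_operator, elliptic & positive_definite_operator].

Definition orthonormal_basis (phi : nat -> 'rV[R]_n -> R) : Prop :=
  [/\ forall k, L2D (phi k),
      forall k l, innerD (phi k) (phi l) = (k == l)%:R
    & forall v, L2D v ->
        L2D_cvg (fun N x => \sum_(k < N) innerD v (phi k) * phi k x) v].

(* The index k : nat stands for k + 1 in the customary numbering from 1. *)
Definition eigensystem (lam : nat -> R) (phi : nat -> 'rV[R]_n -> R) : Prop :=
  [/\ 0 < lam 0%N /\ (forall k, lam k <= lam k.+1),
      forall k, dirichlet_domain (phi k),
      forall k, operator (phi k) (fun x => lam k * phi k x)
    & orthonormal_basis phi].

End sobolev.

Section mittag_leffler.
Context {R : realType}.

(* Meant for x > 0, where the integral converges. *)
Definition Gamma (x : R) : R :=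
  \int[lebesgue_measure]_(t in `]0, +oo[) (t `^ (x - 1) * expR (- t)).

Definition mittag_leffler (alpha beta z : R) : R :=
  limn (series (fun k => z ^+ k / Gamma (k%:R * alpha + beta))).

Definition ml_kernel (alpha lambda t : R) : R :=
  t `^ (alpha - 1) * mittag_leffler alpha alpha (- lambda * t `^ alpha).

End mittag_leffler.

Section wiener.
Context d (Omega : measurableType d) (R : realType).
Variables (P : probability Omega R) (W : R -> {RV P >-> R}).

Definition wiener_process : Prop :=
  [/\ {ae P, forall w, W 0 w = 0},
      {ae P, forall w, {within `[0, +oo[, continuous (fun t => W t w)}},
      forall s t, 0 <= s -> s < t -> forall B : set R, measurable B ->
        P [set w | B (W t w - W s w)] = normal_prob 0 (Num.sqrt (t - s)) B
    & forall (k : nat) (t : nat -> R) (B : nat -> set R),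
        0 <= t 0%N -> (forall i, t i <= t i.+1) ->
        (forall i, measurable (B i)) ->
        P [set w | forall i, (i < k)%N -> B i (W (t i.+1) w - W (t i) w)] =
        (\prod_(i < k) P [set w | B i (W (t i.+1) w - W (t i) w)%R])%E].

(* A sequence of triples (y, (r, s)) encodes the step function
   sum_(y, (r, s)) y * 1_]r, s], the intervals possibly overlapping. *)

Definition step_in (t : R) (q : seq (R * (R * R))) : bool :=
  all (fun p => [&& 0 <= p.2.1, p.2.1 <= p.2.2 & p.2.2 <= t]) q.

Definition step_fun (q : seq (R * (R * R))) (x : R) : R :=
  \sum_(p <- q) p.1 * \1_(`]p.2.1, p.2.2]) x.

Definition step_wiener (q : seq (R * (R * R))) (w : Omega) : R :=
  \sum_(p <- q) p.1 * (W p.2.2 w - W p.2.1 w).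

(* J is a version of the stochastic integral over [0, t] of the deterministic
   function x |-> F x with respect to W. *)
Definition wiener_integral (t : R) (F : R -> R) (J : Omega -> R) : Prop :=
  [/\ L2 lebesgue_measure `]0, t[ F, L2 P setT J &
      exists q : nat -> seq (R * (R * R)),
      [/\ forall k, step_in t (q k),
          L2_cvg lebesgue_measure `]0, t[ (fun k => step_fun (q k)) F
        & L2_cvg P setT (fun k => step_wiener (q k)) J]].

End wiener.

Section mild_solution.
Context d (Omega : measurableType d) (R : realType).
Variables (P : probability Omega R) (W : R -> {RV P >-> R}).
Context {n : nat} (D : set 'rV[R]_n).
Variables (lam : nat -> R) (phi : nat -> 'rV[R]_n -> R).
Variables (alpha T : R) (f g : 'rV[R]_n -> R) (h : R -> R).

Definition I1 (k : nat) (t : R) : R :=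
  inner (lebesgue_rV n) D f (phi k) *
  \int[lebesgue_measure]_(tau in `]0, t[)
    (ml_kernel alpha (lam k) (t - tau) * h tau).

(* J k t is the Wiener integral of tau |-> ml_kernel alpha (lam k) (t - tau),
   so that I2 J k t is the term I_{k,2}(t).  The series defining u(., t)
   converges in L^2(Omega; L^2(D)) = L^2(Omega x D). *)
Definition I2 (J : nat -> R -> Omega -> R) (k : nat) (t : R) (w : Omega) : R :=
  inner (lebesgue_rV n) D g (phi k) * J k t w.

Definition mild_solution (u : R -> Omega -> 'rV[R]_n -> R) : Prop :=
  exists J : nat -> R -> Omega -> R,
    (forall k t, 0 <= t <= T ->
       wiener_integral W t (fun tau => ml_kernel alpha (lam k) (t - tau))
         (J k t)) /\
    forall t, 0 <= t <= T ->
      L2 (P \x lebesgue_rV n)%E (setT `*` D) (fun p => u t p.1 p.2) /\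
      L2_cvg (P \x lebesgue_rV n)%E (setT `*` D)
        (fun N p => \sum_(k < N) (I1 k t + I2 J k t p.1) * phi k p.2)
        (fun p => u t p.1 p.2).

End mild_solution.

Definition coefficient (R : realType) (Omega : Type) (n : nat)
    (D : set 'rV[R]_n) (phi : nat -> 'rV[R]_n -> R) (T : R)
    (u : R -> Omega -> 'rV[R]_n -> R) (k : nat) (w : Omega) : R :=
  inner (lebesgue_rV n) D (u T w) (phi k).

(* Main.v *)
Require Import Defs.
From HB Require Import structures.
From mathcomp Require Import all_boot all_order all_algebra.
From mathcomp Require Import all_classical all_reals all_analysis.
From mathcomp Require Import measurable_realfun ring lra.

Set Implicit Arguments.
Unset Strict Implicit.
Unset Printing Implicit Defensive.
Import Order.TTheory GRing.Theory Num.Theory.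
Import numFieldNormedType.Exports.

Local Open Scope classical_set_scope.
Local Open Scope ring_scope.

(** Because the eigenfunctions are orthonormal, the k-th coefficient of u(., T)
is almost surely f_k A_k + g_k J_k, where K_k denotes the kernel
tau |-> (T - tau)^(alpha-1) E_{alpha,alpha}(- lambda_k (T - tau)^alpha), A_k is
the integral of K_k h over ]0, T[, and J_k is the Wiener integral of K_k.  A
Wiener integral is centred, and by the isometry the expectation of J_i J_j is a
positive multiple of <K_i, K_j>.  Hence (lemma [mild_solution_moments])

   E[u_k(T)] = f_k A_k,     Cov(u_i(T), u_j(T)) = v g_i g_j <K_i, K_j>.

If A_k and <K_i, K_j> do not vanish, the expectations determine every f_k, and
the covariances with index N0 determine the products g_N0 g_k.  The square of
g_N0 is then known and nonzero, so two admissible g differ by a sign that does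
not depend on k; by completeness of the eigenfunctions, f is determined and g is
determined up to this global sign, which the absolute value removes.

What makes A_k and <K_i, K_j> nonzero is that
F(t) = t^(alpha-1) E_{alpha,alpha}(- lambda t^alpha) is positive on ]0, oo[
(lemma [ml_kernel_gt0]).  Complete monotonicity of the Mittag-Leffler function
would give this; the proof here is more elementary.  Summing the series term by
term with the semigroup law of the Riemann-Liouville kernels
k_a(t) = t^(a-1) / Gamma(a) shows that F solves the Volterra equation
F = k - lambda (k convolved with F), where k = k_alpha.  Near 0 the function F
is positive.  If t0 were its first zero, compare the equations at t0 and at a
point c slightly to the left of t0 where F is maximal on an interval ending at
t0.  Since k is log-convex, k(t0 - s) <= (k(t0) / k(c)) k(c - s) for s < c, which
bounds the part of the convolution before c by what the equation at c controls;
the part after c is at most F(c) times a small mass of k.  Together they give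
F(t0) > 0, a contradiction.

On the stochastic side, polarizing E[(W_t - W_s)^2] yields all the covariances of
W, hence the isometry for step functions, which passes to the limit in L^2.  The
factor v is the second moment of the standard normal law; it is positive and
finite, and it cancels when two covariances are compared. *)

(** * Affine changes of variables on the line *)

Section affine.
Context {R : realType}.
Local Notation mu := (@lebesgue_measure R).
Variables c b : R.
Hypothesis c0 : c != 0.

Let phi (x : measurableTypeR R) : measurableTypeR R := c * x + b.

Let mphi : measurable_fun [set: measurableTypeR R] phi.
Proof. by apply: measurable_funD => //; apply: measurable_funM. Qed.

Let image : {measure set (measurableTypeR R) -> \bar R} :=
  measure_function_pushforward__canonical__measure_function_Measure mu mphi.

Let scale : {nonneg R} := NngNum (normr_ge0 c).

Let phi_measure (A : set (measurableTypeR R)) : measurable A ->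
  mu A = mscale scale image A.
Proof.
move=> mA; apply: (@lebesgue_measure_unique R (mscale scale image)) => //.
move=> _ [[x y] /= xy <-].
rewrite /mscale/= /image/= /pushforward.
have [c_gt0|c_lt0|c00] := ltgtP 0 c; last by by move: c0; rewrite -c00 eqxx.
- have -> : phi @^-1` `]x, y] = `](x - b) / c, (y - b) / c]%classic.
    apply/seteqP; split => z; rewrite /= !in_itv/= ltr_pdivrMr// ler_pdivlMr// ltrBlDr lerBrDr mulrC //.
  rewrite !lebesgue_measure_itv/= !lte_fin ltr_pM2r ?invr_gt0// ltrD2r.
  case: ifPn => _; last by rewrite mule0.
  rewrite -!EFinD -EFinM gtr0_norm//; congr EFin; field; lra.
- have -> : phi @^-1` `]x, y] = `[(y - b) / c, (x - b) / c[%classic.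
    apply/seteqP; split => z; rewrite /= !in_itv/= ltr_ndivlMr// ler_ndivrMr// ltrBlDr lerBrDr mulrC andbC //.
  rewrite !lebesgue_measure_itv/= !lte_fin ltr_nM2r ?invr_lt0// ltrD2r.
  case: ifPn => _; last by rewrite mule0.
  rewrite -!EFinD -EFinM ltr0_norm//; congr EFin; field; lra.
Qed.

(** The measure A |-> |c| mu (phi^-1 A), for phi x = c x + b, gives an interval
its length, so it is the Lebesgue measure. *)
Lemma ge0_integral_affine (f : R -> \bar R) :
  measurable_fun [set: R] f -> (forall x, (0 <= f x)%E) ->
  (\int[mu]_x f (c * x + b)%R = `|c|^-1%:E * \int[mu]_x f x)%E.
Proof.
move=> mf f0.
have -> : (\int[mu]_x f x = `|c|%:E * \int[mu]_x f (c * x + b)%R)%E.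
  rewrite (@eq_measure_integral _ _ _ _ (mscale scale image)); last first.
    by move=> A mA _; exact: phi_measure.
  rewrite ge0_integral_mscale//.
  congr (_ * _)%E; rewrite (@ge0_integral_pushforward _ _ _ _ R phi mphi mu setT f)//.
rewrite muleA -EFinM mulVf ?normr_eq0// mul1e//.
Qed.

End affine.

(** * The Gamma integral *)

Section powR_near_zero.
Context {R : realType}.
Local Notation mu := (@lebesgue_measure R).
Implicit Types (a e t : R).

Lemma integral_powR_itv a e : 0 < a -> 0 < e < 1 ->
  (\int[mu]_(t in `[e, 1%R]) (t `^ (a - 1))%:E = (a^-1 * (1 - e `^ a))%:E)%E.
Proof.
move=> a0 /andP[e0 e1].
have der t : 0 < t -> is_derive t 1 (fun t => a^-1 * t `^ a) (t `^ (a - 1)).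
  move=> t0; have d1 : derivable (fun t => t `^ a) t 1.
    by apply: derivable_powR; rewrite in_itv/= t0.
  have : is_derive t 1 (a^-1 \*: (fun t => t `^ a)) (a^-1 *: (a * t `^ (a - 1))).
    apply: is_deriveZ; apply: DeriveDef => //.
    by rewrite -derive1E powR_derive1// in_itv/= t0.
  by rewrite /GRing.scale/= mulrA mulVf ?gt_eqF// mul1r.
have cpow b t : 0 < t -> {for t, continuous (fun t => t `^ b)}.
  move=> t0; apply: differentiable_continuous; apply/derivable1_diffP.
  by apply: derivable_powR; rewrite in_itv/= t0.
have dcont t : 0 < t -> {for t, continuous (fun t => a^-1 * t `^ a)}.
  by move=> t0; apply: cvgM; [exact: cvg_cst|exact: cpow].
rewrite (@continuous_FTC2 R _ (fun t => a^-1 * t `^ a))//.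
- by rewrite powR1 -EFinB; congr EFin; ring.
- apply: continuous_in_subspaceT => t; rewrite inE/= in_itv/= => /andP[et _].
  by apply: cpow; exact: lt_le_trans et.
- split.
  + move=> t; rewrite in_itv/= => /andP[et _].
    by have [] := der _ (lt_trans e0 et).
  + by apply: cvg_at_right_filter; exact: dcont.
  + by apply: cvg_at_left_filter; apply: dcont.
- move=> t; rewrite in_itv/= => /andP[et _]; rewrite derive1E.
  by have [] := der _ (lt_trans e0 et).
Qed.

Lemma integral_powR_near0_lty a : 0 < a ->
  (\int[mu]_(t in `]0%R, 1%R]) (t `^ (a - 1))%:E < +oo)%E.
Proof.
move=> a0.
pose I k : set R := `[k.+2%:R^-1, 1]%classic.
have -> : `]0, 1]%classic = \bigcup_k I k.
  apply/seteqP; split => [t|t [k _]]; rewrite /I/= !in_itv/=.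
    move=> /andP[t0 t1]; exists (Num.truncn t^-1) => //=; rewrite /I/= in_itv/= t1 andbT.
    rewrite invf_ple ?posrE//.
    rewrite (le_trans (ltW (truncnS_gt _)))// ler_nat//.
  by move=> /andP[kt ->]; rewrite andbT (lt_le_trans _ kt)// invr_gt0.
apply: (@le_lt_trans _ _ (a^-1)%:E); last exact: ltry.
have : (\int[mu]_(t in I i) (t `^ (a - 1))%:E @[i --> \oo]
   --> \int[mu]_(t in \bigcup_i I i) (t `^ (a - 1))%:E)%E.
  apply: ge0_nondecreasing_set_cvg_integral => //=.
  - apply/nondecreasing_seqP => k; rewrite subsetEset => t; rewrite /I/=.
    rewrite !in_itv/= => /andP[kt ->]; rewrite andbT (le_trans _ kt)//.
    by rewrite lef_pV2 ?posrE// ler_nat.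
  - by move=> i; exact: measurable_itv.
  - move=> i; apply/measurable_EFinP/measurable_funTS; exact: measurable_powR.
  - by move=> i t _; rewrite lee_fin powR_ge0.
move=> /cvg_lim <-//; apply: lime_le.
  apply: ereal_nondecreasing_is_cvgn.
  apply: ge0_nondecreasing_set_nondecreasing_integral => //.
  - apply/nondecreasing_seqP => k; rewrite subsetEset => t; rewrite /I/=.
    rewrite !in_itv/= => /andP[kt ->]; rewrite andbT (le_trans _ kt)//.
    by rewrite lef_pV2 ?posrE// ler_nat.
  - by move=> i; exact: measurable_itv.
  - move=> i; apply/measurable_EFinP/measurable_funTS; exact: measurable_powR.
  - by move=> i t _; rewrite lee_fin powR_ge0.
apply: nearW => k; rewrite integral_powR_itv//; last first.
  by rewrite invr_gt0 ltr0n/= invf_lt1// ltr1n.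
by rewrite lee_fin ler_piMr ?invr_ge0 ?(ltW a0)// gerBl powR_ge0.
Qed.

(** A power is dominated by an exponential: this is 1 + y <= exp y at
y = t / (2 a), raised to the power a. *)
Lemma powR_le_expR a t : 0 < a -> 0 < t ->
  t `^ a <= (2 * a) `^ a * expR (t / 2).
Proof.
move=> a0 t0; have a20 : 0 < 2 * a by rewrite mulr_gt0.
rewrite -{1}(_ : 2 * a * (t / (2 * a)) = t); last by field; rewrite gt_eqF.
rewrite powRM ?(ltW a20) ?divr_ge0 ?(ltW a20) ?(ltW t0)//.
rewrite ler_wpM2l ?powR_ge0//.
have -> : expR (t / 2) = expR (t / (2 * a)) `^ a.
  by rewrite /powR gt_eqF ?expR_gt0// expRK; congr expR; field; rewrite gt_eqF.
rewrite ge0_ler_powR ?(ltW a0)// ?nnegrE ?expR_ge0 ?divr_ge0 ?(ltW a20) ?(ltW t0)//.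
by apply: le_trans (expR_ge1Dx _); rewrite lerDr.
Qed.

End powR_near_zero.

Lemma measurable_patch d (T : measurableType d) (R : realType) (D : set T)
    (f : T -> R) : measurable D -> measurable_fun setT f ->
  measurable_fun setT ((fun x => (f x)%:E) \_ D).
Proof.
move=> mD mf; apply: (iffLR (measurable_restrictT _ mD)).
by apply/measurable_EFinP; exact: measurable_funTS.
Qed.

Section Gamma_function.
Context {R : realType}.
Local Notation mu := (@lebesgue_measure R).
Implicit Types (a t M : R).

Let gamma_fun a t := t `^ (a - 1) * expR (- t).

Lemma measurable_gamma_fun a : measurable_fun [set: R] (gamma_fun a).
Proof.
apply: measurable_funM; first exact: measurable_powR.
by apply: measurableT_comp.
Qed.

(** The integrand is at most t^(a-1) on ]0, 1] and, by [powR_le_expR], a multiple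
of exp (- t / 2) beyond 1. *)
Lemma integral_Gamma_lty a : 0 < a ->
  (\int[mu]_(t in `]0%R, +oo[) (t `^ (a - 1) * expR (- t))%:E < +oo)%E.
Proof.
move=> a0; pose C := (2 * a) `^ a.
have C0 : 0 <= C by rewrite powR_ge0.
rewrite integral_mkcond.
apply: (@le_lt_trans _ _ (\int[mu]_t (((fun t => (t `^ (a - 1))%:E) \_ `]0%R, 1%R]) t
   + (2 * C)%:E * (exponential_pdf (2^-1) t)%:E)))%E.
  apply: ge0_le_integral => //=.
  - move=> t _; apply: erestrict_ge0 => s _; rewrite lee_fin mulr_ge0 ?powR_ge0 ?expR_ge0//.
  - by apply: measurable_patch => //; exact: measurable_gamma_fun.
  - apply: emeasurable_funD.
      by apply: measurable_patch => //; exact: measurable_powR.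
    apply: measurable_funeM; apply/measurable_EFinP; exact: measurable_exponential_pdf.
  - move=> t _; rewrite !patchE !mem_setE !in_itv/= andbT.
    have [t0|t0] := ltP 0 t => /=; last first.
      by rewrite add0e -EFinM lee_fin mulr_ge0 ?exponential_pdf_ge0// mulr_ge0.
    rewrite exponential_pdfE ?(ltW t0)//.
    have et : 0 <= expR (- 2^-1 * t) by exact: expR_ge0.
    case: ifPn => [t1|].
      rewrite -EFinM -EFinD lee_fin -[leLHS]addr0 lerD//.
        by rewrite ler_piMr ?powR_ge0// -expR0 ler_expR oppr_le0 ltW.
      by rewrite !mulr_ge0.
    rewrite -ltNge => t1; rewrite add0e -EFinM lee_fin.
    have -> : 2 * C * (2^-1 * expR (- 2^-1 * t)) = C * expR (t / 2) * expR (- t).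
      rewrite -[RHS]mulrA -expRD (_ : t / 2 - t = - 2^-1 * t); by field.
    rewrite ler_wpM2r ?expR_ge0//; apply: le_trans (powR_le_expR a0 t0).
    by rewrite ler_powR ?(ltW t1)// gerBl.
rewrite ge0_integralD//=.
- apply: lte_add_pinfty.
    by rewrite -integral_mkcond integral_powR_near0_lty.
  rewrite ge0_integralZl//=; last 3 first.
  - by apply/measurable_EFinP; exact: measurable_exponential_pdf.
  - by move=> t _; rewrite lee_fin exponential_pdf_ge0.
  - by rewrite lee_fin mulr_ge0.
  by rewrite integral_exponential_pdf ?invr_gt0// mule1 ltry.
- by move=> t _; apply: erestrict_ge0 => s _; rewrite lee_fin powR_ge0.
- by apply: measurable_patch => //; exact: measurable_powR.
- by move=> t _; rewrite -EFinM lee_fin mulr_ge0 ?exponential_pdf_ge0// mulr_ge0.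
- apply: measurable_funeM; apply/measurable_EFinP; exact: measurable_exponential_pdf.
Qed.

Lemma EFin_Gamma a : 0 < a ->
  ((Gamma a)%:E = \int[mu]_(t in `]0%R, +oo[) (t `^ (a - 1) * expR (- t))%:E)%E.
Proof.
move=> a0; rewrite /Gamma /Rintegral fineK// ge0_fin_numE.
  exact: integral_Gamma_lty.
by apply: integral_ge0 => t _; rewrite lee_fin mulr_ge0 ?powR_ge0 ?expR_ge0.
Qed.

(** Only the part of the integral over [M, M + 1] is kept.  As M is arbitrary,
Gamma grows faster than any geometric sequence: the Mittag-Leffler series has
infinite radius of convergence. *)
Lemma Gamma_ge a M : 0 < a -> 0 < M ->
  M `^ a * ((M + 1)^-1 * expR (- (M + 1))) <= Gamma a.
Proof.
move=> a0 M0; rewrite -lee_fin EFin_Gamma//.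
apply: (@le_trans _ _ (\int[mu]_(t in `[M, (M + 1)%R]) (M `^ a * ((M + 1)^-1 * expR (- (M + 1))))%:E)%E).
  rewrite integral_cst//= lebesgue_measure_itv/= lte_fin ltrDl ltr01.
  by rewrite -EFinD addrAC subrr add0r mule1.
apply: (@le_trans _ _ (\int[mu]_(t in `[M, (M + 1)%R]) (gamma_fun a t)%:E)%E).
  apply: ge0_le_integral => //=.
  - move=> t _; rewrite lee_fin !mulr_ge0 ?powR_ge0 ?expR_ge0 ?invr_ge0//; lra.
  - apply/measurable_EFinP; apply: measurable_funTS; exact: measurable_gamma_fun.
  - move=> t; rewrite in_itv/= => /andP[Mt tM]; rewrite lee_fin /gamma_fun.
    have t0 : 0 < t by lra.
    rewrite mulrA ler_pM ?expR_ge0 ?ler_expR ?lerN2//.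
      by rewrite mulr_ge0 ?powR_ge0// invr_ge0; lra.
    rewrite powRB; last by apply/implyP => _; rewrite gt_eqF.
    rewrite powRr1 ?(ltW t0)// ler_pM ?powR_ge0 ?invr_ge0//; first lra.
      by rewrite ge0_ler_powR ?nnegrE// ltW.
    by rewrite lef_pV2 ?posrE//; lra.
apply: ge0_subset_integral => //=.
- apply/measurable_EFinP; apply: measurable_funTS; exact: measurable_gamma_fun.
- by move=> t _; rewrite lee_fin mulr_ge0 ?powR_ge0 ?expR_ge0.
- by move=> t /=; rewrite !in_itv/= andbT => /andP[+ _]; exact: lt_le_trans.
Qed.

Lemma Gamma_gt0 a : 0 < a -> 0 < Gamma a.
Proof.
move=> a0; apply: lt_le_trans (Gamma_ge a0 (@ltr01 R)).
by rewrite !mulr_gt0 ?powR_gt0 ?expR_gt0 ?invr_gt0.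
Qed.

End Gamma_function.

(** * Riemann-Liouville kernels *)

Section riemann_liouville.
Context {R : realType}.
Local Notation mu := (@lebesgue_measure R).
Implicit Types (a b s t u : R).

(** The kernel of the fractional integral of order a.  It vanishes on the negative
half-line, so that a convolution over [0, t] is an integral over the line. *)
Definition rl_kernel a t : R := if 0 < t then t `^ (a - 1) / Gamma a else 0.

Lemma rl_ge0 a t : 0 < a -> 0 <= rl_kernel a t.
Proof.
move=> a0; rewrite /rl_kernel; case: ifPn => // t0.
by rewrite divr_ge0 ?powR_ge0// ltW// Gamma_gt0.
Qed.

Lemma rl_gt0 a t : 0 < a -> 0 < t -> 0 < rl_kernel a t.
Proof. by move=> a0 t0; rewrite /rl_kernel t0 divr_gt0 ?powR_gt0 ?Gamma_gt0. Qed.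

Lemma rl_le0 a t : t <= 0 -> rl_kernel a t = 0.
Proof. by move=> t0; rewrite /rl_kernel ltNge t0. Qed.

Lemma rlE a t : 0 < t -> rl_kernel a t = t `^ (a - 1) / Gamma a.
Proof. by rewrite /rl_kernel => ->. Qed.

Lemma measurable_rl a : measurable_fun [set: R] (rl_kernel a).
Proof.
apply: measurable_fun_ifT => //.
- by apply: measurable_fun_ltr => //; exact: measurable_id.
- by apply: measurable_funM => //; exact: measurable_powR.
Qed.

Lemma rlM a u t : 0 < u -> rl_kernel a (u * t) = u `^ (a - 1) * rl_kernel a t.
Proof.
move=> u0; rewrite /rl_kernel pmulr_rgt0//; case: ifPn => t0; last by rewrite mulr0.
by rewrite powRM ?(ltW u0) ?(ltW t0)// mulrA.
Qed.

Let gamma_density a t := rl_kernel a t * expR (- t).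

Let measurable_gamma_density a : measurable_fun [set: R] (gamma_density a).
Proof.
apply: measurable_funM; first exact: measurable_rl.
exact: measurableT_comp.
Qed.

Let gamma_density_ge0 a t : 0 < a -> 0 <= gamma_density a t.
Proof. by move=> a0; rewrite mulr_ge0 ?expR_ge0 ?rl_ge0. Qed.

Lemma integral_rl_expR a : 0 < a -> (\int[mu]_t (rl_kernel a t * expR (- t))%:E = 1)%E.
Proof.
move=> a0; have G0 := Gamma_gt0 a0.
transitivity (\int[mu]_(t in `]0%R, +oo[)
   ((Gamma a)^-1%:E * (t `^ (a - 1) * expR (- t))%:E))%E.
  rewrite [RHS]integral_mkcond; apply: eq_integral => t _.
  rewrite patchE mem_setE in_itv/= andbT /rl_kernel; case: ifPn => t0; last by rewrite mul0r.
  by rewrite -EFinM; congr EFin; rewrite mulrAC mulrC mulrA.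
rewrite ge0_integralZl//=.
- by rewrite -EFin_Gamma// -EFinM mulVf// gt_eqF.
- apply/measurable_EFinP; apply: measurable_funTS; exact: measurable_gamma_fun.
- by move=> t _; rewrite lee_fin mulr_ge0 ?powR_ge0 ?expR_ge0.
- by rewrite lee_fin invr_ge0 ltW.
Qed.

Lemma measurable_rl_conv a b t :
  measurable_fun [set: R] (fun s => rl_kernel a (t - s) * rl_kernel b s).
Proof.
apply: measurable_funM; last exact: measurable_rl.
apply: measurableT_comp; first exact: measurable_rl.
exact: measurable_funB.
Qed.

Let measurable_EFin_rl_conv a b t :
  measurable_fun [set: R] (fun s => (rl_kernel a (t - s) * rl_kernel b s)%:E).
Proof. by apply/measurable_EFinP; exact: measurable_rl_conv. Qed.

(** Substitute s = t v and use that the kernels are homogeneous: the convolution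
is a power of t, up to its value at 1. *)
Lemma rl_conv_homogeneous a b t : 0 < a -> 0 < b -> 0 < t ->
  (\int[mu]_s (rl_kernel a (t - s) * rl_kernel b s)%:E =
   (t `^ (a + b - 1))%:E * \int[mu]_s (rl_kernel a (1 - s) * rl_kernel b s)%:E)%E.
Proof.
move=> a0 b0 t0.
have tn0 : t != 0 by rewrite gt_eqF.
have m : measurable_fun [set: R] (fun s => (rl_kernel a (t - s) * rl_kernel b s)%:E).
  exact: measurable_EFin_rl_conv.
have p s : (0 <= (rl_kernel a (t - s) * rl_kernel b s)%:E)%E.
  by rewrite lee_fin mulr_ge0 ?rl_ge0.
have E : (forall x y, x = `|t|^-1%:E * y -> y = t%:E * x)%E.
  by move=> x y ->; rewrite muleA -EFinM gtr0_norm// divff// mul1e.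
rewrite (E _ _ (ge0_integral_affine 0 tn0 m p)).
under eq_integral => s _.
  have -> : t - (t * s + 0) = t * (1 - s) by ring.
  rewrite addr0 !rlM// mulrACA EFinM; over.
rewrite ge0_integralZl//=.
- rewrite muleA -EFinM; congr (_%:E * _)%E.
  rewrite -powRD; last by apply/implyP => _; rewrite gt_eqF.
  rewrite -{1}(powRr1 (ltW t0)) -powRD; last by apply/implyP => _; rewrite gt_eqF.
  congr (_ `^ _); ring.
- exact: measurable_EFin_rl_conv.
- by move=> s _; rewrite lee_fin mulr_ge0 ?rl_ge0.
- by rewrite lee_fin mulr_ge0 ?powR_ge0.
Qed.

(** The Euler Beta integral.  The gamma densities k_a(t) exp (- t) have total mass 1,
so their convolution has mass 1 too; by homogeneity it is a multiple of the
density of index a + b, and comparing the masses gives the factor. *)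
Lemma rl_conv1 a b : 0 < a -> 0 < b ->
  (\int[mu]_s (rl_kernel a (1 - s) * rl_kernel b s)%:E = (Gamma (a + b))^-1%:E)%E.
Proof.
move=> a0 b0; set c := (\int[mu]_s _)%E.
have ab0 : 0 < a + b by rewrite addr_gt0.
have c0 : (0 <= c)%E by apply: integral_ge0 => s _; rewrite lee_fin mulr_ge0 ?rl_ge0.
suff : (c * (Gamma (a + b))%:E = 1)%E.
  move=> /(congr1 (fun x => x * (Gamma (a + b))^-1%:E)%E).
  by rewrite -muleA -EFinM divff ?gt_eqF ?Gamma_gt0// mule1 mul1e.
pose f (p : measurableTypeR R * measurableTypeR R) :=
  (gamma_density a (p.2 - p.1) * gamma_density b p.1)%:E.
have mf : measurable_fun setT f.
  apply/measurable_EFinP; apply: measurable_funM.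
    apply: (measurableT_comp (measurable_gamma_density a)).
    by apply: measurable_funB.
  exact: (measurableT_comp (measurable_gamma_density b)).
have f0 p : (0 <= f p)%E by rewrite lee_fin mulr_ge0 ?gamma_density_ge0.
have := @fubini_tonelli _ _ _ _ R mu mu f mf f0.
have -> : (\int[mu]_x \int[mu]_y f (x, y) = 1)%E.
  rewrite -(integral_rl_expR b0); apply: eq_integral => s _.
  rewrite /f/=; under eq_integral do rewrite EFinM.
  rewrite ge0_integralZr//=.
  - have := @ge0_integral_affine R 1 (- s) _ (fun s => (gamma_density a s)%:E).
    rewrite oner_eq0 normr1 invr1 mul1e integral_rl_expR// => H.
    under eq_integral => y _ do rewrite -{1}(mul1r y).
    rewrite H ?mul1e//; first by apply/measurable_EFinP.
    by move=> x; rewrite lee_fin gamma_density_ge0.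
  - apply/measurable_EFinP; apply: measurableT_comp => //.
    exact: measurable_funB.
  - by move=> y _; rewrite lee_fin gamma_density_ge0.
  - by rewrite lee_fin gamma_density_ge0.
move=> ->.
transitivity (\int[mu]_u (c * (Gamma (a + b))%:E * (rl_kernel (a + b) u * expR (- u))%:E))%E.
  rewrite ge0_integralZl//=.
  - by rewrite integral_rl_expR// mule1.
  - by apply/measurable_EFinP; exact: measurable_gamma_density.
  - by move=> u _; rewrite lee_fin mulr_ge0 ?expR_ge0 ?rl_ge0.
  - by rewrite mule_ge0// lee_fin ltW// Gamma_gt0.
apply: eq_integral => u _; rewrite /f/=.
have -> : (fun x => (gamma_density a (u - x) * gamma_density b x)%:E) =
    (fun x => (expR (- u))%:E * (rl_kernel a (u - x) * rl_kernel b x)%:E)%E.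
  apply/funext => x; rewrite -EFinM /gamma_density; congr EFin.
  by rewrite mulrACA -expRD mulrC; congr (expR _ * _); ring.
rewrite ge0_integralZl//=; last 2 first.
- exact: measurable_EFin_rl_conv.
- by move=> s _; rewrite lee_fin mulr_ge0 ?rl_ge0.
have [u0|u0] := ltP 0 u; last first.
  rewrite (rl_le0 _ u0) mul0r mule0 integral0_eq ?mule0// => s _.
  have [s0|s0] := leP s 0; first by rewrite (rl_le0 _ s0) mulr0.
  by rewrite rl_le0 ?mul0r//; lra.
rewrite rl_conv_homogeneous// -/c /rl_kernel u0 [RHS]muleA [RHS]muleC -muleA.
by rewrite -!EFinM; congr (c * _%:E)%E; field; rewrite gt_eqF// Gamma_gt0.
Qed.

(** The semigroup law k_a * k_b = k_(a+b). *)
Lemma rl_conv a b t : 0 < a -> 0 < b ->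
  (\int[mu]_s (rl_kernel a (t - s) * rl_kernel b s)%:E = (rl_kernel (a + b) t)%:E)%E.
Proof.
move=> a0 b0; have [t0|t0] := ltP 0 t; last first.
  rewrite (rl_le0 _ t0) integral0_eq// => s _.
  have [s0|s0] := leP s 0; first by rewrite (rl_le0 _ s0) mulr0.
  by rewrite rl_le0 ?mul0r//; lra.
by rewrite rl_conv_homogeneous// rl_conv1// -EFinM /rl_kernel t0.
Qed.

End riemann_liouville.

(** * Mittag-Leffler functions *)

Section entire_series.
Context {R : realType}.
Implicit Types (c : R^nat) (x : R).

(** Infinite radius of convergence, stated as a bound on the coefficients because
this form passes to the differentiated series at once. *)
Definition entire_coefficients c := forall q, 0 < q -> exists C, forall k, `|c k| * q ^+ k <= C.

Lemma entire_coefficients_diffs c :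
  entire_coefficients c -> entire_coefficients (pseries_diffs c).
Proof.
move=> ec q q0; have q20 : 0 < 2 * q by rewrite mulr_gt0.
have [C HC] := ec _ q20; exists (q^-1 * C) => k.
apply: (@le_trans _ _ (q^-1 * (`|c k.+1| * (2 * q) ^+ k.+1))); last first.
  by rewrite ler_wpM2l// invr_ge0 ltW.
rewrite /pseries_diffs normrM exprMn [q ^+ k.+1]exprS.
have -> : q^-1 * (`|c k.+1| * (2 ^+ k.+1 * (q * q ^+ k))) =
   2 ^+ k.+1 * (`|c k.+1| * q ^+ k) by field; rewrite gt_eqF.
rewrite -mulrA ler_wpM2r ?mulr_ge0 ?exprn_ge0 ?(ltW q0)//.
by rewrite ger0_norm// -natrX ler_nat ltnW// ltn_expl.
Qed.

Lemma entire_coefficients_cvg_normed c x : entire_coefficients c ->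
  cvgn (series (fun k => `|c k| * `|x| ^+ k)).
Proof.
move=> ec; have q0 : 0 < 2 * `|x| + 1 by rewrite ltr_wpDl// mulr_ge0.
have [C HC] := ec _ q0.
apply: (@series_le_cvg _ _ (geometric C (2^-1))).
- by move=> k; rewrite mulr_ge0 ?exprn_ge0.
- move=> k; apply: geometric_ge0; last by rewrite invr_ge0.
  by apply: le_trans (HC 0%N); rewrite mulr_ge0 ?exprn_ge0 ?(ltW q0).
- move=> k; rewrite /geometric/= exprVn -[leLHS](@mulfK _ (2 ^+ k)); last first.
    by rewrite expf_eq0 andbC/= pnatr_eq0.
  rewrite ler_wpM2r ?invr_ge0 ?exprn_ge0//; apply: le_trans (HC k).
  rewrite -mulrA ler_wpM2l// -exprMn lerXn2r ?nnegrE ?mulr_ge0 ?(ltW q0)//.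
  by rewrite mulrC lerDl.
- by apply: is_cvg_geometric_series; rewrite ger0_norm ?invr_ge0// invf_lt1// ltr1n.
Qed.

Lemma entire_coefficients_cvg c x : entire_coefficients c -> cvgn (pseries c x).
Proof.
move=> ec; apply: normed_cvg.
have := @entire_coefficients_cvg_normed c x ec.
rewrite (_ : (fun k => `|c k| * `|x| ^+ k) = (fun k => `|c k * x ^+ k|))//.
by apply/funext => k; rewrite normrM normrX.
Qed.

Lemma continuous_entire_series c : entire_coefficients c ->
  continuous (fun x => limn (pseries c x)).
Proof.
move=> ec x; apply: differentiable_continuous; apply/derivable1_diffP.
have [] // := @pseries_snd_diffs _ c (`|x| + 1) x.
- exact: entire_coefficients_cvg.
- exact/entire_coefficients_cvg/entire_coefficients_diffs.
- exact/entire_coefficients_cvg/entire_coefficients_diffs/entire_coefficients_diffs.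
- by rewrite [ltRHS]ger0_norm ?addr_ge0// ltrDl.
Qed.

End entire_series.

Section mittag_leffler_kernel.
Context {R : realType}.
Local Notation mu := (@lebesgue_measure R).
Variable alpha : R.
Hypothesis alpha0 : 0 < alpha.
Implicit Types (z s t : R).

(** [Gamma_ge] with M^alpha = q. *)
Lemma entire_mittag_leffler beta : 0 < beta ->
  entire_coefficients (fun k => (Gamma (k%:R * alpha + beta))^-1).
Proof.
move=> beta0 q q0; pose M := q `^ (alpha^-1).
have M0 : 0 < M by rewrite powR_gt0.
pose K := M `^ beta * ((M + 1)^-1 * expR (- (M + 1))).
have K0 : 0 < K by rewrite !mulr_gt0 ?powR_gt0 ?expR_gt0// invr_gt0 addr_gt0.
exists (K^-1) => k.
have kab : 0 < k%:R * alpha + beta by rewrite ltr_wpDl// mulr_ge0// ltW.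
have G0 := Gamma_gt0 kab.
rewrite ger0_norm ?invr_ge0 ?(ltW G0)// mulrC ler_pdivrMr// mulrC ler_pdivlMr//.
apply: le_trans (Gamma_ge kab M0).
rewrite powRD; last by apply/implyP => _; rewrite gt_eqF.
rewrite /K mulrA le_eqVlt; apply/orP; left; apply/eqP; congr (_ * _ * _).
rewrite /M -powRrM [k%:R * _]mulrC mulrA mulVf ?gt_eqF// mul1r powR_mulrn//.
exact: ltW.
Qed.

Lemma continuous_mittag_leffler beta : 0 < beta ->
  continuous (mittag_leffler alpha beta).
Proof.
move=> beta0; have := continuous_entire_series (entire_mittag_leffler beta0).
rewrite (_ : (fun x => _) = mittag_leffler alpha beta)//; apply/funext => z.
by congr (limn (series _)); apply/funext => k; rewrite mulrC.
Qed.

Lemma mittag_leffler0 beta : 0 < beta ->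
  mittag_leffler alpha beta 0 = (Gamma beta)^-1.
Proof.
move=> beta0; apply/cvg_lim => //; apply: cvg_near_cst; near=> n.
have n0 : (0 < n)%N by near: n; exists 1%N.
rewrite /series/= -(prednK n0) big_nat_recl//= big1 ?addr0.
  by rewrite expr0 mul0r add0r mul1r.
by move=> i _; rewrite expr0n/= mul0r.
Unshelve. all: by end_near. Qed.

(** The function t^(alpha-1) E_{alpha,alpha}(z t^alpha), extended by 0: the
resolvent of the kernel k_alpha for the parameter z.  For z = - lambda it is
[ml_kernel]. *)
Definition resolvent z t : R :=
  if 0 < t then t `^ (alpha - 1) * mittag_leffler alpha alpha (z * t `^ alpha) else 0.

Lemma resolvent_le0 z t : t <= 0 -> resolvent z t = 0.
Proof. by move=> t0; rewrite /resolvent ltNge t0. Qed.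

Definition resolvent_sum z t : R^nat := series (fun k => z ^+ k * rl_kernel (k.+1%:R * alpha) t).

Let kalpha0 k : 0 < k.+1%:R * alpha. Proof. by rewrite mulr_gt0. Qed.

(** Distributing t^(alpha-1) over the Mittag-Leffler series turns its terms into
multiples of Riemann-Liouville kernels. *)
Lemma cvg_resolvent_sum z t : resolvent_sum z t @ \oo --> resolvent z t.
Proof.
rewrite /resolvent; have [t0|t0] := ltP 0 t; last first.
  rewrite (_ : resolvent_sum z t = cst 0); first exact: cvg_cst.
  by apply/funext => n; rewrite /resolvent_sum/series/= big1// => k _; rewrite rl_le0// mulr0.
rewrite (_ : resolvent_sum z t = (fun n => t `^ (alpha - 1) *
    series (fun k => (z * t `^ alpha) ^+ k / Gamma (k%:R * alpha + alpha)) n)).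
  apply: cvgMl_tmp; rewrite /mittag_leffler.
  have := @entire_coefficients_cvg _ _ (z * t `^ alpha) (entire_mittag_leffler alpha0).
  rewrite /pseries; set u := (fun k => _); set v := (fun k => _).
  by have -> : u = v by apply/funext => k; rewrite /u mulrC.
apply/funext => n; rewrite /resolvent_sum/series/= mulr_sumr; apply: eq_bigr => k _.
rewrite /rl_kernel t0 exprMn.
rewrite -(powR_mulrn k (powR_ge0 t alpha)) -powRrM -natr1 mulrDl mul1r [_%:R * _]mulrC.
rewrite -addrA (@powRD _ _ (alpha * k%:R)); last by apply/implyP => _; rewrite gt_eqF.
set x := _ `^ _; set y := _ `^ _; ring.
Qed.

Lemma resolvent_sum_nondecreasing z t : 0 <= z -> nondecreasing_seq (resolvent_sum z t).
Proof.
move=> z0; apply/nondecreasing_seqP => n.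
rewrite /resolvent_sum /series/= big_nat_recr//= lerDl.
by rewrite mulr_ge0 ?exprn_ge0 ?rl_ge0.
Qed.

Lemma resolvent_sum_ge0 z t n : 0 <= z -> 0 <= resolvent_sum z t n.
Proof.
by move=> z0; apply: sumr_ge0 => k _; rewrite mulr_ge0 ?exprn_ge0 ?rl_ge0.
Qed.

Lemma normr_resolvent_sum_le z t n : `|resolvent_sum z t n| <= resolvent `|z| t.
Proof.
apply: (@le_trans _ _ (resolvent_sum `|z| t n)).
  rewrite (le_trans (ler_norm_sum _ _ _))//; apply: ler_sum => k _.
  by rewrite normrM normrX (ger0_norm (rl_ge0 _ _)).
have cl := @cvg_resolvent_sum `|z| t.
rewrite -(cvg_lim _ cl)//; apply: nondecreasing_cvgn_le.
  exact: resolvent_sum_nondecreasing.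
by apply/cvg_ex; eexists; exact: cl.
Qed.

Lemma resolvent_ge0 z t : 0 <= z -> 0 <= resolvent z t.
Proof.
move=> z0; have := normr_resolvent_sum_le z t 0.
by rewrite (ger0_norm z0); apply: le_trans; exact: normr_ge0.
Qed.

End mittag_leffler_kernel.

(** * The Volterra equation *)

Section volterra.
Context {R : realType}.
Local Notation mu := (@lebesgue_measure R).
Variable alpha : R.
Hypothesis alpha0 : 0 < alpha.
Implicit Types (z s t : R).
Local Notation resolvent := (resolvent alpha).
Local Notation resolvent_sum := (resolvent_sum alpha).
Let kalpha0 k : 0 < k.+1%:R * alpha. Proof. by rewrite mulr_gt0. Qed.

Lemma integrable_rl_conv a b t : 0 < a -> 0 < b ->
  mu.-integrable setT (EFin \o (fun s => rl_kernel a (t - s) * rl_kernel b s)).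
Proof.
move=> a0 b0; apply/integrableP; split.
  by apply/measurable_EFinP; exact: measurable_rl_conv.
under eq_integral => s _ do rewrite /= ger0_norm ?mulr_ge0 ?rl_ge0//.
by rewrite rl_conv// ltry.
Qed.

Let term z t k s := rl_kernel alpha (t - s) * (z ^+ k * rl_kernel (k.+1%:R * alpha) s).

Let termC z t k s : term z t k s = z ^+ k * (rl_kernel alpha (t - s) * rl_kernel (k.+1%:R * alpha) s).
Proof. exact: mulrCA. Qed.

Let term_integrable z t k : mu.-integrable setT (EFin \o term z t k).
Proof.
have := integrableZl measurableT (z ^+ k) (integrable_rl_conv t alpha0 (kalpha0 k)).
by apply: eq_integrable => // s _; rewrite /= termC EFinM.
Qed.

Let termE z t k : (\int[mu]_s (term z t k s)%:E = (z ^+ k * rl_kernel (k.+2%:R * alpha) t)%:E)%E.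
Proof.
under eq_integral => s _ do rewrite termC EFinM.
rewrite integralZl//; last exact: integrable_rl_conv.
have -> : k.+2%:R * alpha = alpha + k.+1%:R * alpha.
  by rewrite -[k.+2%:R]natr1 mulrDl mul1r addrC.
by rewrite (rl_conv t alpha0 (kalpha0 k)) [RHS]EFinM.
Qed.

Let sumE z t n s : rl_kernel alpha (t - s) * resolvent_sum z s n = \sum_(0 <= k < n) term z t k s.
Proof. by rewrite mulr_sumr. Qed.

Lemma integrable_rl_resolvent_sum z t n :
  mu.-integrable setT (EFin \o (fun s => rl_kernel alpha (t - s) * resolvent_sum z s n)).
Proof.
rewrite (_ : EFin \o _ = fun s => (\sum_(0 <= k < n) (term z t k s)%:E)%E); last first.
  by apply/funext => s /=; rewrite sumE sumEFin.
by apply: integrable_sum => // k _; exact: term_integrable.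
Qed.

(** Convolution with k_alpha shifts the series of the resolvent by one term. *)
Lemma integral_rl_resolvent_sum z t n :
  (z%:E * \int[mu]_s (rl_kernel alpha (t - s) * resolvent_sum z s n)%:E =
   (resolvent_sum z t n.+1 - rl_kernel alpha t)%:E)%E.
Proof.
under eq_integral => s _ do rewrite sumE -sumEFin.
rewrite integral_sum//; last by move=> k; exact: term_integrable.
under eq_bigr => k _ do rewrite termE.
rewrite sumEFin -EFinM /resolvent_sum /series/= big_nat_recl//= expr0 !mul1r addrAC subrr add0r.
by congr EFin; rewrite mulr_sumr; apply: eq_bigr => k _; rewrite exprS mulrA.
Qed.

Let cvg_integral z t : z != 0 -> (\int[mu]_s (rl_kernel alpha (t - s) * resolvent_sum z s n)%:E
   @[n --> \oo] --> (z^-1 * (resolvent z t - rl_kernel alpha t))%:E)%E.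
Proof.
move=> z0.
have -> : (fun n => \int[mu]_s (rl_kernel alpha (t - s) * resolvent_sum z s n)%:E)%E =
    (fun n => (z^-1 * (resolvent_sum z t n.+1 - rl_kernel alpha t))%:E).
  apply/funext => n; rewrite EFinM -integral_rl_resolvent_sum.
  by rewrite muleA -EFinM mulVf// mul1e.
apply: cvg_EFin; first exact: nearW.
apply: cvgMl_tmp; apply: cvgB; last exact: cvg_cst.
by have := @cvg_resolvent_sum _ _ alpha0 z t; rewrite -(cvg_shiftS (resolvent_sum z t)).
Qed.

(** For a positive parameter the partial sums increase, so their integrals, which
[integral_rl_resolvent_sum] computes, converge to the integral of the limit. *)
Lemma integrable_rl_resolvent_gt0 z t : 0 < z ->
  mu.-integrable setT (EFin \o (fun s => rl_kernel alpha (t - s) * resolvent z s)).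
Proof.
move=> z0; have resolvent_lim s : (rl_kernel alpha (t - s) * resolvent_sum z s n)%:E @[n --> \oo] -->
    (rl_kernel alpha (t - s) * resolvent z s)%:E.
  apply: cvg_EFin; first exact: nearW.
  by apply: cvgMl_tmp; exact: cvg_resolvent_sum.
have mt n : measurable_fun [set: R] (fun s => (rl_kernel alpha (t - s) * resolvent_sum z s n)%:E).
  by have /measurable_int := integrable_rl_resolvent_sum z t n.
apply/integrableP; split.
  apply: (emeasurable_fun_cvg (fun n s => (rl_kernel alpha (t - s) * resolvent_sum z s n)%:E)) => //.
apply: (@le_lt_trans _ _ (z^-1 * (resolvent z t - rl_kernel alpha t))%:E); last exact: ltry.
have z1 : z != 0 by rewrite gt_eqF.
rewrite -(cvg_lim _ (@cvg_integral _ t z1))// -monotone_convergence//.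
- rewrite le_eqVlt; apply/orP; left; apply/eqP.
  apply: eq_integral => s _; rewrite (cvg_lim _ (resolvent_lim s))//= ger0_norm//.
  by rewrite mulr_ge0 ?rl_ge0 ?resolvent_ge0// ltW.
- by move=> n s _; rewrite lee_fin mulr_ge0 ?rl_ge0 ?resolvent_sum_ge0// ltW.
- move=> s _; apply/nondecreasing_seqP => n; rewrite lee_fin ler_wpM2l ?rl_ge0//.
  by move/nondecreasing_seqP : (resolvent_sum_nondecreasing alpha0 s (ltW z0)).
Qed.

(** The limit of [integral_rl_resolvent_sum]; the resolvent with parameter |z|
dominates the partial sums. *)
Lemma resolvent_volterra z t : z != 0 ->
  mu.-integrable setT (EFin \o (fun s => rl_kernel alpha (t - s) * resolvent z s)) /\
  resolvent z t = rl_kernel alpha t + z * \int[mu]_s (rl_kernel alpha (t - s) * resolvent z s).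
Proof.
move=> z0; have nz0 : 0 < `|z| by rewrite normr_gt0.
have resolvent_lim s : (rl_kernel alpha (t - s) * resolvent_sum z s n)%:E @[n --> \oo] -->
    (rl_kernel alpha (t - s) * resolvent z s)%:E.
  apply: cvg_EFin; first exact: nearW.
  by apply: cvgMl_tmp; exact: cvg_resolvent_sum.
have mt n : measurable_fun [set: R] (fun s => (rl_kernel alpha (t - s) * resolvent_sum z s n)%:E).
  by have /measurable_int := integrable_rl_resolvent_sum z t n.
have [||||i1 _ i2] := @dominated_convergence _ _ R mu setT measurableT
  (fun n s => (rl_kernel alpha (t - s) * resolvent_sum z s n)%:E)
  (fun s => (rl_kernel alpha (t - s) * resolvent z s)%:E)
  (fun s => (rl_kernel alpha (t - s) * resolvent `|z| s)%:E) mt.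
- apply: (emeasurable_fun_cvg (fun n s => (rl_kernel alpha (t - s) * resolvent_sum z s n)%:E)) => //.
- by apply: aeW => s _; exact: resolvent_lim.
- exact: integrable_rl_resolvent_gt0.
- apply: aeW => s n _ /=; rewrite lee_fin normrM ger0_norm ?rl_ge0// ler_wpM2l ?rl_ge0//.
  exact: normr_resolvent_sum_le.
split; first exact: i1.
have E := cvg_unique _ i2 (@cvg_integral _ t z0).
by rewrite /Rintegral E//= mulrA divff// mul1r addrCA subrr addr0.
Qed.

End volterra.

(** * Positivity of the resolvent *)

Section resolvent_positivity.
Context {R : realType}.
Local Notation mu := (@lebesgue_measure R).
Variables alpha lambda : R.
Hypotheses (alpha0 : 0 < alpha) (alpha1 : alpha < 1) (lambda0 : 0 < lambda).
Implicit Types (s t c : R).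
Local Notation F := (resolvent alpha (- lambda)).

Lemma powR_le0_anti (p x y : R) : p <= 0 -> 0 < x -> x <= y -> y `^ p <= x `^ p.
Proof.
move=> p0 x0 xy; have y0 : 0 < y by exact: lt_le_trans xy.
rewrite -[p]opprK !(powRN _ (- p)) lef_pV2 ?posrE ?powR_gt0//.
by rewrite ge0_ler_powR ?nnegrE ?oppr_ge0// ltW.
Qed.

Let rl_ratioE c t : 0 < c -> 0 < t ->
  rl_kernel alpha t / rl_kernel alpha c = t `^ (alpha - 1) / c `^ (alpha - 1).
Proof.
move=> c0 t0; rewrite !rlE//; have G0 := Gamma_gt0 alpha0.
have c10 : 0 < c `^ (alpha - 1) by rewrite powR_gt0.
by move: G0 c10; move: (Gamma alpha) (c `^ _) => G x G0 x0; field; rewrite !gt_eqF.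
Qed.

(** The point where log-convexity of t |-> t^(alpha-1), that is alpha <= 1, is used:
the ratio k(t - s) / k(c - s) decreases with s. *)
Lemma rl_log_convex s c t : 0 < s -> s < c -> c < t ->
  rl_kernel alpha (t - s) <= rl_kernel alpha t / rl_kernel alpha c * rl_kernel alpha (c - s).
Proof.
move=> s0 sc ct; have c0 := lt_trans s0 sc; have t0 := lt_trans c0 ct.
have st := lt_trans sc ct.
rewrite rl_ratioE// !rlE ?subr_gt0// mulrA.
rewrite ler_pM2r ?invr_gt0 ?Gamma_gt0// mulrAC ler_pdivlMr ?powR_gt0//.
rewrite -!powRM ?subr_ge0 ?(ltW t0) ?(ltW c0) ?(ltW sc) ?(ltW st)//.
apply: powR_le0_anti; [by rewrite subr_le0 ltW|by rewrite mulr_gt0// subr_gt0|].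
by rewrite mulrBr mulrBl lerD2l lerN2 mulrC ler_pM2r// ltW.
Qed.

Lemma rl_ratio_ge_half c t : 0 < c -> c < t -> t <= 2 * c ->
  2^-1 <= rl_kernel alpha t / rl_kernel alpha c.
Proof.
move=> c0 ct tc; have t0 := lt_trans c0 ct; rewrite rl_ratioE//.
rewrite ler_pdivlMr ?powR_gt0//.
apply: (@le_trans _ _ ((2 * c) `^ (alpha - 1))); last first.
  by apply: powR_le0_anti => //; rewrite subr_le0 ltW.
rewrite powRM ?(ltW c0)// ler_wpM2r ?powR_ge0//.
by rewrite -powR_inv1// ler_powR ?ler1n// lerBrDr addNr ltW.
Qed.

(** k_(alpha+1) is the primitive of k_alpha: this says that k_alpha has little mass
near 0. *)
Lemma rl_small_near0 (e t : R) : 0 < e -> 0 < t ->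
  exists2 m, 0 < m <= t & rl_kernel (alpha + 1) m < e.
Proof.
move=> e0 t0; have a10 : 0 < alpha + 1 by rewrite addr_gt0.
have Ga : 0 < Gamma (alpha + 1) by exact: Gamma_gt0.
pose B := e / 2 * Gamma (alpha + 1); have B0 : 0 < B by rewrite mulr_gt0// divr_gt0.
pose r := B `^ alpha^-1; have r0 : 0 < r by rewrite powR_gt0.
pose m := Num.min t r; have m0 : 0 < m by rewrite lt_min t0.
exists m; first by rewrite m0 ge_min lexx.
rewrite rlE// addrK ltr_pdivrMr//.
apply: (@le_lt_trans _ _ (r `^ alpha)).
  by rewrite ge0_ler_powR ?nnegrE ?(ltW m0) ?(ltW r0) ?(ltW alpha0)// ge_min lexx orbT.
rewrite /r -powRrM mulVf ?gt_eqF// powRr1 ?(ltW B0)// /B ltr_pM2r//.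
by rewrite ltr_pdivrMr// mulr_natr mulr2n ltrDl.
Qed.

Lemma rl_conv_shift a b t c : 0 < a -> 0 < b ->
  (\int[mu]_s (rl_kernel a (t - s) * rl_kernel b (s - c))%:E = (rl_kernel (a + b) (t - c))%:E)%E.
Proof.
move=> a0 b0; rewrite -(rl_conv (t - c) a0 b0).
have m : measurable_fun [set: R] (fun s => (rl_kernel a (t - s) * rl_kernel b (s - c))%:E).
  apply/measurable_EFinP; apply: measurable_funM.
    by apply: measurableT_comp; [exact: measurable_rl|exact: measurable_funB].
  by apply: measurableT_comp; [exact: measurable_rl|exact: measurable_funB].
have p s : (0 <= (rl_kernel a (t - s) * rl_kernel b (s - c))%:E)%E.
  by rewrite lee_fin mulr_ge0 ?rl_ge0.
have := @ge0_integral_affine R 1 c (oner_neq0 _) _ m p.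
rewrite normr1 invr1 mul1e => <-; apply: eq_integral => s _.
have -> : t - (1 * s + c) = t - c - s by ring.
by have -> : 1 * s + c - c = s by ring.
Qed.

Lemma integrable_rl_conv_shift a b t c : 0 < a -> 0 < b ->
  mu.-integrable setT (EFin \o (fun s => rl_kernel a (t - s) * rl_kernel b (s - c))).
Proof.
move=> a0 b0; apply/integrableP; split.
  apply/measurable_EFinP; apply: measurable_funM.
    by apply: measurableT_comp; [exact: measurable_rl|exact: measurable_funB].
  by apply: measurableT_comp; [exact: measurable_rl|exact: measurable_funB].
under eq_integral => s _ do rewrite /= ger0_norm ?mulr_ge0 ?rl_ge0//.
by rewrite rl_conv_shift// ltry.
Qed.

Lemma continuous_resolvent z t : 0 < t -> {for t, continuous (resolvent alpha z)}.
Proof.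
move=> t0.
have cpow b : {for t, continuous (fun t => t `^ b)}.
  apply: differentiable_continuous; apply/derivable1_diffP.
  by apply: derivable_powR; rewrite in_itv/= t0.
have : (fun t => t `^ (alpha - 1) * mittag_leffler alpha alpha (z * t `^ alpha))
    @ t --> resolvent alpha z t.
  rewrite /resolvent t0; apply: cvgM; first exact: cpow.
  apply: (@continuous_comp _ _ _ (fun t => z * t `^ alpha) (mittag_leffler alpha alpha)).
    by apply: cvgM; [exact: cvg_cst|exact: cpow].
  exact: continuous_mittag_leffler.
apply: cvg_trans; apply: near_eq_cvg.
near=> s; rewrite /resolvent ifT//; near: s.
exact: (@cvgr_gt _ _ _ _ id t cvg_id 0 t0).
Unshelve. all: by end_near. Qed.

(** As t tends to 0, E_{alpha,alpha} tends to its value 1 / Gamma(alpha) at 0. *)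
Let F_pos_near0 : exists2 d, 0 < d & forall t, 0 < t -> t < d -> 0 < F t.
Proof.
have ml0 : 0 < mittag_leffler alpha alpha 0.
  by rewrite mittag_leffler0// invr_gt0 Gamma_gt0.
have := @continuous_mittag_leffler R _ alpha0 _ alpha0 0.
move=> /(cvgr_gt _) /(_ _ ml0)/nbhs_ballP[e /= e0 H].
exists ((e / lambda) `^ alpha^-1); first by rewrite powR_gt0 ?divr_gt0.
move=> t t0 td; rewrite /resolvent t0 mulr_gt0 ?powR_gt0//; apply: H.
rewrite /ball/= sub0r normrN normrM normrN !gtr0_norm ?powR_gt0//.
rewrite mulrC -ltr_pdivlMr//.
have := @gt0_ltr_powR R _ alpha0 t ((e / lambda) `^ alpha^-1).
rewrite !nnegrE powR_ge0 (ltW t0) => /(_ isT isT td).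
by rewrite -powRrM mulVf ?gt_eqF// powRr1// ltW// divr_gt0.
Qed.

(** The arithmetic of the contradiction.  Here k0 and kc are the values of the
kernel at t0 and c, i0 and ic the convolution integrals at these points, x the
value of the resolvent at c, and g r a bound on the mass of the kernel after c. *)
Let volterra_lower_bound (l k0 kc rho i0 ic x g r : R) : 0 < l -> rho * kc = k0 ->
  x = kc + - l * ic -> i0 <= rho * ic + x * g * r -> l * (g * r) < 2^-1 ->
  2^-1 <= rho -> 0 < x -> 0 < k0 + - l * i0.
Proof.
move=> l0 <- xE i0le small half x0.
have : l * i0 <= l * (rho * ic + x * g * r) by rewrite ler_pM2l.
have -> : l * (rho * ic + x * g * r) = rho * kc - rho * x + x * (l * (g * r)).
  have -> : rho * kc = rho * x + rho * l * ic by rewrite xE; ring.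
  by ring.
have H2 : x * (l * (g * r)) < x * 2^-1 by rewrite ltr_pM2l.
have H3 : x * 2^-1 <= rho * x by rewrite mulrC ler_pM2r.
lra.
Qed.

Local Opaque rl_kernel resolvent Gamma.

(** There is no first zero.  The bound on the convolution at t0 dominates the
integrand by two terms: before c, log-convexity reduces it to the convolution at
c; after c, the resolvent is at most its value at c.  The indicator of
s > c1 is written as Gamma(1) k_1(s - c1), which makes its integral against the
kernel an instance of the semigroup law. *)
Let F_pos_extends t0 : 0 < t0 -> (forall t, 0 < t -> t < t0 -> 0 < F t) -> 0 < F t0.
Proof.
move=> t00 Fpos.
pose G1 : R := Gamma 1; have G10 : 0 < G1 by exact: Gamma_gt0.
have [m /andP[m0 mt0] msmall] : exists2 m, 0 < m <= t0 / 2 &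
    rl_kernel (alpha + 1) m < (2 * lambda * G1)^-1.
  by apply: rl_small_near0; rewrite ?invr_gt0 ?divr_gt0 ?mulr_gt0.
pose c1 := t0 - m.
have c1small : lambda * (G1 * rl_kernel (alpha + 1) (t0 - c1)) < 2^-1.
  rewrite /c1 subKr mulrA -ltr_pdivlMl ?mulr_gt0//.
  by rewrite -invfM [_ * 2]mulrC mulrA.
have c1t0 : c1 < t0 by rewrite ltrBlDr ltrDl.
have c1half : t0 / 2 <= c1 by rewrite /c1; lra.
pose t1 := (c1 + t0) / 2.
have t1t0 : t1 < t0 by rewrite /t1; lra.
have c1t1 : c1 < t1 by rewrite /t1; lra.
have t10 : 0 < t1 by lra.
(* F is maximal at c on [t1, t0], and c lies in ]c1, t0], where the kernel has little
mass; if c = t0 then F(t0) >= F(t1) > 0. *)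
have [|c] := @EVT_max R F t1 t0 (ltW t1t0).
  apply: continuous_in_subspaceT => t; rewrite inE/= in_itv/= => /andP[tt _].
  by apply: continuous_resolvent; exact: lt_le_trans tt.
rewrite in_itv/= => /andP[t1c]; rewrite le_eqVlt => /predU1P[-> |ct0] Fmax.
  by apply: lt_le_trans (Fmax t1 _); [exact: Fpos|rewrite in_itv/= lexx ltW].
have c1c := lt_le_trans c1t1 t1c.
have c0 : 0 < c := lt_le_trans t10 t1c.
have Fc0 : 0 < F c by exact: Fpos.
have nl0 : - lambda != 0 by rewrite oppr_eq0 gt_eqF.
have [i0 ->] := resolvent_volterra alpha0 t0 nl0.
have [ic Ec] := resolvent_volterra alpha0 c nl0.
pose rho := rl_kernel alpha t0 / rl_kernel alpha c.
have rho0 : 0 < rho by rewrite divr_gt0 ?rl_gt0.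
have rho_half : 2^-1 <= rho.
  apply: rl_ratio_ge_half => //.
  by rewrite -ler_pdivrMl// mulrC (le_trans c1half)// ltW.
pose g s := rl_kernel alpha (t0 - s) * rl_kernel 1 (s - c1).
have ig : mu.-integrable setT (EFin \o g) by exact: integrable_rl_conv_shift.
have igE : \int[mu]_s g s = rl_kernel (alpha + 1) (t0 - c1).
  by rewrite /Rintegral rl_conv_shift.
have key : \int[mu]_s (rl_kernel alpha (t0 - s) * F s) <=
    \int[mu]_s (rho * (rl_kernel alpha (c - s) * F s) + F c * G1 * g s).
  apply: le_Rintegral => //.
    have := integrableD measurableT (integrableZl measurableT rho ic)
      (integrableZl measurableT (F c * G1) ig).
    by apply: eq_integrable.
  have gFc s : 0 <= F c * G1 * g s by rewrite !mulr_ge0 ?rl_ge0// ltW.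
  move=> s _; have [s0|s0] := leP s 0.
    by rewrite (resolvent_le0 _ _ s0) !mulr0 add0r.
  have [sc|cs] := ltP s c.
    rewrite -[leLHS]addr0; apply: lerD; last exact: gFc.
    rewrite mulrA; apply: ler_wpM2r; last exact: rl_log_convex.
    by apply: ltW; apply: Fpos => //; exact: lt_trans sc ct0.
  have [st|ts] := ltP s t0; last first.
    rewrite [rl_kernel alpha (t0 - s)]rl_le0 ?subr_le0// mul0r addr_ge0//.
    by rewrite [rl_kernel alpha (c - s)]rl_le0 ?subr_le0// mul0r mulr0.
  rewrite [rl_kernel alpha (c - s)]rl_le0 ?subr_le0// mul0r mulr0 add0r.
  have G1E : G1 * rl_kernel 1 (s - c1) = 1.
    rewrite rlE ?subr_gt0; last exact: lt_le_trans c1c cs.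
    by rewrite subrr powRr0 mul1r mulfV// gt_eqF.
  rewrite /g mulrACA G1E mulr1 [F c * _]mulrC ler_wpM2l ?rl_ge0//; apply: Fmax.
  by rewrite in_itv/= (ltW st) andbT (le_trans t1c).
have I0le : \int[mu]_s (rl_kernel alpha (t0 - s) * F s) <=
    rho * \int[mu]_s (rl_kernel alpha (c - s) * F s) + F c * G1 * rl_kernel (alpha + 1) (t0 - c1).
  apply: le_trans key _; rewrite RintegralD//.
  - by rewrite !RintegralZl// igE.
  - by have := integrableZl measurableT rho ic; apply: eq_integrable.
  - by have := integrableZl measurableT (F c * G1) ig; apply: eq_integrable.
have rhoc : rho * rl_kernel alpha c = rl_kernel alpha t0 by rewrite /rho divfK// gt_eqF// rl_gt0.
exact: (volterra_lower_bound lambda0 rhoc Ec I0le c1small rho_half Fc0).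
Qed.

(** The infimum of the points where the resolvent is not positive would be a first
zero: it is away from 0 by [F_pos_near0], and [F_pos_extends] with continuity
gives positivity on a neighbourhood of it. *)
Lemma resolvent_gt0 t : 0 < t -> 0 < F t.
Proof.
move=> t0; rewrite ltNge; apply/negP => Ft.
pose A := [set s | 0 < s /\ F s <= 0].
have hA : has_inf A.
  by split; [exists t|exists 0 => s [/ltW]].
have [d d0 Hd] := F_pos_near0.
have infA0 : 0 < inf A.
  apply: (lt_le_trans d0); apply: lb_le_inf; first by exists t.
  by move=> s [s0 Fs]; rewrite leNgt; apply/negP => sd; have := Hd _ s0 sd; rewrite ltNge Fs.
have : 0 < F (inf A).
  apply: F_pos_extends => // s s0 sA; rewrite ltNge; apply/negP => Fs.
  by have := ge_inf hA.2 (conj s0 Fs : A s); rewrite leNgt sA.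
move=> FA; have := @continuous_resolvent (- lambda) _ infA0.
move=> /(cvgr_gt _) /(_ _ FA)/nbhs_ballP[e /= e0 H].
have [a Aa ae] := inf_adherent e0 hA.
have : 0 < F a.
  apply: H; rewrite /ball/= distrC ger0_norm; last by rewrite subr_ge0 ge_inf//; exact: hA.2.
  by rewrite ltrBlDl.
by rewrite ltNge Aa.2.
Qed.

End resolvent_positivity.

Lemma ml_kernel_gt0 (R : realType) (alpha lambda t : R) :
  0 < alpha -> alpha < 1 -> 0 < lambda -> 0 < t -> 0 < ml_kernel alpha lambda t.
Proof.
by move=> alpha0 alpha1 lambda0 t0; have := resolvent_gt0 alpha0 alpha1 lambda0 t0; rewrite /resolvent t0.
Qed.

(** * Square-integrable functions *)

Section L2_toolkit.
Context d (T : measurableType d) (R : realType) (mu : {measure set T -> \bar R}).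
Implicit Types f g : T -> R.
Local Notation L2 := (Lfun mu 2%:E).
Local Notation N f := (fine ('N[mu]_2%:E [EFin \o f])).

Lemma Lfun_measurable p f : f \in Lfun mu p -> measurable_fun setT f.
Proof. by rewrite inE => /andP[/[!inE]]. Qed.

Lemma Lfun2_lty f : f \in L2 -> ('N[mu]_2%:E [EFin \o f] < +oo)%E.
Proof. by rewrite inE => /andP[_]; rewrite inE. Qed.

Lemma Lfun2_fin f : f \in L2 -> 'N[mu]_2%:E [EFin \o f]%E \is a fin_num.
Proof. by move=> /Lfun2_lty; rewrite ge0_fin_numE ?Lnorm_ge0. Qed.

Lemma Lfun2_mul_integrable f g : f \in L2 -> g \in L2 ->
  mu.-integrable setT (EFin \o (fun x => f x * g x)).
Proof. by move=> f2 g2; apply/Lfun1_integrable; exact: Lfun2_mul_Lfun1. Qed.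

Lemma Lfun2B f g : f \in L2 -> g \in L2 -> f \- g \in L2.
Proof. by move=> f2 g2; rewrite -[f \- g]/(f - g) rpredB// lee1n. Qed.

Lemma cauchy_schwarz_Rintegral f g : f \in L2 -> g \in L2 ->
  `|\int[mu]_x (f x * g x)| <= N f * N g.
Proof.
move=> f2 g2; have fg := Lfun2_mul_integrable f2 g2.
apply: (le_trans (le_normr_Rintegral _ fg)) => //.
rewrite -fineM ?Lfun2_fin// /Rintegral; apply: fine_le.
- by apply: integrable_fin_num => //; exact: integrable_norm.
- by rewrite fin_numM ?Lfun2_fin.
have <- : 'N[mu]_1 [EFin \o (f \* g)%R]%E = (\int[mu]_x `|f x * g x|%:E)%E.
  by rewrite Lnorm1.
apply: hoelder; [exact: Lfun_measurable f2|exact: Lfun_measurable g2|by []|by []|].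
by rewrite [RHS]splitr !div1r.
Qed.

(** Continuity of the inner product for convergence in norm. *)
Lemma cvg_Lfun2_mul (F G : nat -> T -> R) f g :
  (forall k, F k \in L2) -> f \in L2 -> (forall k, G k \in L2) -> g \in L2 ->
  ('N[mu]_2%:E [EFin \o (F k \- f)%R])%E @[k --> \oo] --> 0%E ->
  ('N[mu]_2%:E [EFin \o (G k \- g)%R])%E @[k --> \oo] --> 0%E ->
  (\int[mu]_x (F k x * G k x))%R @[k --> \oo] --> (\int[mu]_x (f x * g x))%R.
Proof.
pose a k := N (F k \- f); pose b k := N (G k \- g).
move=> F2 f2 G2 g2 /fine_cvg Ff /fine_cvg Gg.
have {}Ff : a k @[k --> \oo] --> 0 := Ff.
have {}Gg : b k @[k --> \oo] --> 0 := Gg.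
have lim0 : a k * b k + a k * N g + N f * b k @[k --> \oo] --> 0 * 0 + 0 * N g + N f * 0.
  apply: cvgD; last by apply: cvgMl_tmp.
  by apply: cvgD; [exact: cvgM|exact: cvgMr_tmp].
rewrite !(mul0r, mulr0, addr0) in lim0.
set l := \int[mu]_x (f x * g x).
pose e k := a k * b k + a k * N g + N f * b k.
have lim1 : l - e k @[k --> \oo] --> l by rewrite -[X in _ --> X]subr0; apply: cvgB lim0; exact: cvg_cst.
have lim2 : l + e k @[k --> \oo] --> l by rewrite -[X in _ --> X]addr0; apply: cvgD lim0; exact: cvg_cst.
apply: (squeeze_cvgr _ lim1 lim2).
apply: nearW => k; rewrite -ler_distl /l /e.
have Fk2 := Lfun2B (F2 k) f2; have Gk2 := Lfun2B (G2 k) g2.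
have i1 := Lfun2_mul_integrable Fk2 Gk2.
have i2 := Lfun2_mul_integrable Fk2 g2.
have i3 := Lfun2_mul_integrable f2 Gk2.
have -> : \int[mu]_x (F k x * G k x) - \int[mu]_x (f x * g x) =
   \int[mu]_x ((F k \- f) x * (G k \- g) x) + \int[mu]_x ((F k \- f) x * g x)
    + \int[mu]_x (f x * (G k \- g) x).
  rewrite -RintegralB//; [|exact: Lfun2_mul_integrable..].
  rewrite -RintegralD// -RintegralD//.
    by apply: eq_Rintegral => x _ /=; ring.
  have := integrableD measurableT i1 i2.
  by apply: eq_integrable.
rewrite (le_trans (ler_normD _ _))// lerD//; last exact: cauchy_schwarz_Rintegral.
by rewrite (le_trans (ler_normD _ _))// lerD//; exact: cauchy_schwarz_Rintegral.
Qed.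

Lemma Lnorm2_sqr f : ('N[mu]_2%:E [EFin \o f] * 'N[mu]_2%:E [EFin \o f] =
  \int[mu]_x (f x ^+ 2)%:E)%E.
Proof.
have n2 : (2%R : R) != 0 by rewrite pnatr_eq0.
transitivity ('N[mu]_2%:E [EFin \o f] `^ 2)%E.
  have -> : 2 = 1 + 1 :> R by rewrite -(natrD _ 1 1).
  by rewrite poweRD ?poweRe1 ?Lnorm_ge0// add_neq0_poweRD_def// -(natrD _ 1 1).
rewrite powR_Lnorm//; apply: eq_integral => x _.
by rewrite /= powR_mulrn// real_normK// num_real.
Qed.

Lemma Lnorm2_eq0 f : measurable_fun setT f -> 'N[mu]_2%:E [EFin \o f]%E = 0%E ->
  {ae mu, forall x, f x = 0}.
Proof.
move=> mf /Lnorm_eq0_eq0 H.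
have := H (iffRL (measurable_EFinP _ _) mf) (ltr0Sn _ _).
by apply: filterS => x /(_ I) [].
Qed.

End L2_toolkit.

(** * Moments of the normal distribution *)

Section normal_moments.
Context {R : realType}.
Local Notation mu := (@lebesgue_measure R).
Implicit Types (s x : R).

(** The density is the Radon-Nikodym derivative almost everywhere, since both have
the same integral over every measurable set. *)
Lemma ge0_integral_normal_prob m s (f : R -> \bar R) :
  measurable_fun [set: R] f -> (forall x, (0 <= f x)%E) ->
  (\int[normal_prob m s]_x f x = \int[mu]_x (f x * (normal_pdf m s x)%:E))%E.
Proof.
move=> mf f0; have dom := normal_prob_dominates m s.
rewrite -(Radon_Nikodym_SigmaFinite.change_of_variables dom)//.
have ig := Radon_Nikodym_SigmaFinite.f_integrable dom.
have mpdf : measurable_fun [set: R] (fun x => (normal_pdf m s x)%:E).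
  by apply/measurable_EFinP; exact: measurable_normal_pdf.
apply: ae_eq_integral => //.
- by apply: emeasurable_funM => //; exact: measurable_int ig.
- exact: emeasurable_funM.
- apply: ae_eqe_mul2l; apply: integral_ae_eq => //= A _ mA.
  by rewrite -Radon_Nikodym_SigmaFinite.f_integral.
Qed.

Lemma normal_pdf_scale s x : 0 < s ->
  normal_pdf 0 s (s * x) = s^-1 * normal_pdf 0 1 x.
Proof.
move=> s0; rewrite !normal_pdfE ?gt_eqF// /normal_peak /normal_fun.
rewrite mulrA !subr0 expr1n mul1r exprMn; congr (_ * expR _).
  by rewrite -mulrnAr sqrtrM ?sqr_ge0// sqrtr_sqr gtr0_norm// invfM.
by field; rewrite gt_eqF.
Qed.

Lemma normal_pdfN s x : s != 0 -> normal_pdf 0 s (- x) = normal_pdf 0 s x.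
Proof. by move=> s0; rewrite !normal_pdfE// /normal_fun !subr0 sqrrN. Qed.

(** The second moment of the standard normal distribution, left unevaluated: it is
a positive finite factor common to all the covariances. *)
Definition normal_moment2 : R := fine (\int[mu]_x (x ^+ 2 * normal_pdf 0 1 x)%:E)%E.

Let measurable_sqr_pdf s : measurable_fun [set: R] (fun x => (x ^+ 2 * normal_pdf 0 s x)%:E).
Proof.
apply/measurable_EFinP; apply: measurable_funM => //.
exact: measurable_normal_pdf.
Qed.

Let sqr_pdf_ge0 s x : (0 <= (x ^+ 2 * normal_pdf 0 s x)%:E)%E.
Proof. by rewrite lee_fin mulr_ge0 ?sqr_ge0 ?normal_pdf_ge0. Qed.

(** From x^2 / 4 <= exp (x^2 / 4), half of the Gaussian exponent absorbs x^2; what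
remains is a multiple of the normal density of variance 2. *)
Lemma normal_moment2_lty : (\int[mu]_x (x ^+ 2 * normal_pdf 0 1 x)%:E < +oo)%E.
Proof.
pose s : R := Num.sqrt 2.
have s0 : s != 0 by rewrite sqrtr_eq0 -ltNge.
pose C : R := 4 * (normal_peak 1 / normal_peak s).
have C0 : 0 <= C by rewrite mulr_ge0// divr_ge0// normal_peak_ge0.
apply: (@le_lt_trans _ _ (\int[mu]_x (C%:E * (normal_pdf 0 s x)%:E))%E).
  apply: ge0_le_integral => //=.
    exact: measurable_sqr_pdf.
    by apply: measurable_funeM; apply/measurable_EFinP; exact: measurable_normal_pdf.
  move=> x _; rewrite -EFinM lee_fin !normal_pdfE ?oner_neq0//.
  rewrite /normal_fun !subr0 expr1n sqr_sqrtr//.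
  have p0 := normal_peak_gt0 s0.
  have -> : C * (normal_peak s * expR (- x ^+ 2 / (2 *+ 2))) =
     normal_peak 1 * (4 * expR (- x ^+ 2 / 4)).
    rewrite /C (_ : 2 *+ 2 = 4); last by rewrite -mulr_natr -natrM.
    by move: p0 (expR _) => /gt_eqF p0 e; field; rewrite p0.
  rewrite mulrCA ler_wpM2l ?normal_peak_ge0//.
  have -> : expR (- x ^+ 2 / (1 *+ 2)) = expR (- x ^+ 2 / 4) * expR (- x ^+ 2 / 4).
    by rewrite -expRD; congr expR; field.
  rewrite mulrA ler_wpM2r ?expR_ge0// mulNr expRN ler_pdivrMr ?expR_gt0//.
  rewrite -ler_pdivrMl// mulrC; apply: le_trans (expR_ge1Dx _).
  by rewrite lerDr.
rewrite ge0_integralZl//=.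
- by rewrite integral_normal_pdf mule1 ltry.
- by apply/measurable_EFinP; exact: measurable_normal_pdf.
- by move=> x _; rewrite lee_fin normal_pdf_ge0.
Qed.

(** The integrand is bounded below on [1, 2]. *)
Lemma normal_moment2_gt0 : 0 < normal_moment2.
Proof.
apply: fine_gt0; rewrite normal_moment2_lty andbT.
pose m := normal_pdf 0 (1:R) 2.
have m0 : 0 < m.
  by rewrite /m normal_pdfE ?oner_neq0// mulr_gt0 ?normal_peak_gt0 ?oner_neq0 ?expR_gt0.
apply: (@lt_le_trans _ _ (\int[mu]_(x in `[1%R, 2%R]) m%:E)%E).
  rewrite integral_cst//= lebesgue_measure_itv/= lte_fin ltr1n/=.
  by rewrite -EFinD -EFinM lte_fin mulr_gt0// subr_gt0 ltr1n.
apply: (@le_trans _ _ (\int[mu]_(x in `[1%R, 2%R]) (x ^+ 2 * normal_pdf 0 1 x)%:E)%E).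
  apply: ge0_le_integral => //=.
  - by move=> x _; rewrite lee_fin ltW.
  - by apply: measurable_funTS; exact: measurable_sqr_pdf.
  - move=> x; rewrite in_itv/= => /andP[x1 x2]; rewrite lee_fin -[m]mul1r ler_pM ?(ltW m0)//.
      by rewrite exprn_ege1.
    rewrite /m !normal_pdfE ?oner_neq0// ler_wpM2l ?normal_peak_ge0//.
    rewrite ler_expR !subr0 !mulNr lerN2 ler_wpM2r ?invr_ge0 ?expr1n//.
    by rewrite lerXn2r ?nnegrE//; lra.
by apply: ge0_subset_integral => //=; exact: measurable_sqr_pdf.
Qed.

Lemma integral_normal_prob_sqr s : 0 < s ->
  (\int[normal_prob 0 s]_x (x ^+ 2)%:E = (normal_moment2 * s ^+ 2)%:E)%E.
Proof.
move=> s0; rewrite ge0_integral_normal_prob//; last 2 first.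
- by apply/measurable_EFinP.
- by move=> x; rewrite lee_fin sqr_ge0.
under eq_integral => x _ do rewrite -EFinM.
have sn0 : s != 0 by rewrite gt_eqF.
have := ge0_integral_affine 0 sn0 (measurable_sqr_pdf s) (sqr_pdf_ge0 s).
have -> : (\int[mu]_x ((s * x + 0) ^+ 2 * normal_pdf 0 s (s * x + 0))%:E =
    s%:E * \int[mu]_x (x ^+ 2 * normal_pdf 0 1 x)%:E)%E.
  rewrite -ge0_integralZl//; last 2 first.
  - exact: measurable_sqr_pdf.
  - by rewrite lee_fin ltW.
  apply: eq_integral => x _; rewrite addr0 normal_pdf_scale// -EFinM; congr EFin.
  by field.
have -> : (\int[mu]_x (x ^+ 2 * normal_pdf 0 1 x)%:E = normal_moment2%:E)%E.
  rewrite fineK// ge0_fin_numE; first exact: normal_moment2_lty.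
  by apply: integral_ge0 => x _; exact: sqr_pdf_ge0.
have E (y : \bar R) : (s%:E * normal_moment2%:E = `|s|^-1%:E * y ->
    y = (normal_moment2 * s ^+ 2)%:E)%E.
  move=> /(congr1 (fun z => s%:E * z)%E).
  rewrite [RHS]muleA -[in RHS]EFinM gtr0_norm// divff// mul1e => <-.
  by rewrite -!EFinM; congr EFin; ring.
exact: E.
Qed.

Lemma normal_prob_opp s (A : set R) : s != 0 -> measurable A ->
  normal_prob 0 s ((-%R : _ -> measurableTypeR R) @^-1` A) = normal_prob 0 s A.
Proof.
move=> s0 mA; rewrite /normal_prob [LHS]integral_mkcond [RHS]integral_mkcond.
have m1 : measurable_fun [set: R] ((fun x => (normal_pdf 0 s x)%:E) \_ A).
  by apply: measurable_patch => //; exact: measurable_normal_pdf.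
have N1 : -1 != 0 :> R by rewrite oppr_eq0 oner_neq0.
have := ge0_integral_affine 0 N1 m1; rewrite normrN1 invr1 mul1e => <-.
  apply: eq_integral => x _; rewrite !patchE mulN1r addr0 normal_pdfN//.
by move=> x; apply: erestrict_ge0 => y _; rewrite lee_fin normal_pdf_ge0.
Qed.

End normal_moments.

(** * Wiener integrals of deterministic functions *)

Section gaussian.
Context d (Omega : measurableType d) (R : realType) (P : probability Omega R).
Variables (X : Omega -> R) (s : R).
Hypotheses (mX : measurable_fun setT X) (s0 : 0 < s).
Hypothesis XN : forall B : set R, measurable B -> P (X @^-1` B) = normal_prob 0 s B.

Let mX' : measurable_fun setT (X : Omega -> measurableTypeR R).
Proof. exact: mX. Qed.

Let image : {measure set (measurableTypeR R) -> \bar R} :=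
  measure_function_pushforward__canonical__measure_function_Measure P mX'.

Let integral_sqr : (\int[P]_w (X w ^+ 2)%:E = (normal_moment2 * s ^+ 2)%:E)%E.
Proof.
rewrite -integral_normal_prob_sqr//.
transitivity (\int[image]_x (x ^+ 2)%:E)%E; last first.
  by apply: eq_measure_integral => A mA _; exact: XN.
rewrite (@ge0_integral_pushforward _ _ _ _ R _ mX' P setT (fun x => (x ^+ 2)%:E))//.
- exact/measurable_EFinP.
- by move=> x _; rewrite lee_fin sqr_ge0.
Qed.

Lemma gaussian_Lfun2 : X \in Lfun P 2%:E.
Proof.
rewrite inE; apply/andP; split; rewrite inE//=.
rewrite /finite_norm; apply: (@lty_poweRy _ _ 2); first by rewrite pnatr_eq0.
rewrite powR_Lnorm ?pnatr_eq0//.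
under eq_integral => w _ do rewrite /= powR_mulrn// real_normK ?num_real//.
by rewrite integral_sqr ltry.
Qed.

Lemma gaussian_second_moment : \int[P]_w (X w * X w) = normal_moment2 * s ^+ 2.
Proof.
rewrite /Rintegral; under eq_integral => w _ do rewrite -expr2.
by rewrite integral_sqr.
Qed.

Let X1 : P.-integrable setT (EFin \o X).
Proof.
apply/Lfun1_integrable; apply: Lfun_subset12; first exact: fin_num_measure.
exact: gaussian_Lfun2.
Qed.

Let mNX : measurable_fun setT (fun w => - X w : measurableTypeR R).
Proof. exact: measurableT_comp. Qed.

Let image_opp : {measure set (measurableTypeR R) -> \bar R} :=
  measure_function_pushforward__canonical__measure_function_Measure P mNX.

(** X and - X have the same law, so their integrals, one the opposite of the other,
are equal. *)
Lemma gaussian_mean : \int[P]_w X w = 0.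
Proof.
have NX1 : P.-integrable setT (EFin \o (fun w => - X w)).
  exact: integrableN X1.
have e1 : (\int[P]_w (X w)%:E = \int[image]_x x%:E)%E.
  by rewrite (@integral_pushforward _ _ _ _ R _ mX' P setT (fun x => x%:E))//; exact/measurable_EFinP.
have e2 : (\int[P]_w (- X w)%:E = \int[image_opp]_x x%:E)%E.
  by rewrite (@integral_pushforward _ _ _ _ R _ mNX P setT (fun x => x%:E))//; exact/measurable_EFinP.
have e3 : (\int[image]_x x%:E = \int[image_opp]_x x%:E)%E.
  apply: eq_measure_integral => A mA _; rewrite /image/= /pushforward XN//.
  rewrite -(@normal_prob_opp _ s A) ?gt_eqF// -XN//.
  by rewrite -[X in measurable X]setTI; exact: oppr_measurable.
have e4 : \int[P]_w (- X w) = \int[P]_w X w by rewrite /Rintegral e1 e2 e3.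
have e5 : \int[P]_w (- X w) = - \int[P]_w X w.
  under eq_Rintegral => w _ do rewrite -mulN1r.
  by rewrite RintegralZl// mulN1r.
lra.
Qed.

End gaussian.

Section step_combinations.
Context d (T : measurableType d) (R : realType) (mu : {measure set T -> \bar R}).
Variables (t : R) (b : R -> T -> R).
Hypothesis b2 : forall s, 0 <= s <= t -> b s \in Lfun mu 2%:E.
Implicit Types (q : seq (R * (R * R))).

(** One formula for both sides of the isometry: with the variables W_s - W_0 for b
it gives [step_wiener], with the indicators of ]0, s] it gives [step_fun]. *)
Definition step_comb q (x : T) : R := \sum_(p <- q) p.1 * (b p.2.2 x - b p.2.1 x).

Lemma step_in_cons p q : step_in t (p :: q) ->
  [/\ 0 <= p.2.1 <= t, 0 <= p.2.2 <= t, p.2.1 <= p.2.2 & step_in t q].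
Proof.
rewrite /step_in/= => /andP[/and3P[p0 p1 p2] ->].
by rewrite p0 p1 p2 (le_trans p1)// (le_trans p0).
Qed.

Lemma step_comb_Lfun2 q : step_in t q -> step_comb q \in Lfun mu 2%:E.
Proof.
elim: q => [_|p q ih /step_in_cons[p1 p2 _ /ih q2]].
  rewrite (_ : step_comb [::] = 0); first by rewrite rpred0// lee1n.
  by apply/funext => x; rewrite /step_comb big_nil.
have -> : step_comb (p :: q) = (p.1 \o* (b p.2.2 \- b p.2.1) : T -> R) + step_comb q.
  by apply/funext => x; rewrite /step_comb big_cons !fctE/= mulrC.
rewrite rpredD ?lee1n// => *.
apply: Lfun_scale; first by rewrite ler1n.
by apply: Lfun2B; exact: b2.
Qed.

Lemma step_comb_inner q g : step_in t q -> g \in Lfun mu 2%:E ->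
  \int[mu]_x (step_comb q x * g x) =
  \sum_(p <- q) p.1 * (\int[mu]_x (b p.2.2 x * g x) - \int[mu]_x (b p.2.1 x * g x)).
Proof.
move=> + g2; elim: q => [_|p q ih /step_in_cons[p1 p2 _ qin]].
  rewrite big_nil; under eq_Rintegral => x _ do rewrite /step_comb big_nil mul0r.
  by rewrite Rintegral_cst// mul0r.
rewrite big_cons -ih//.
have i1 := Lfun2_mul_integrable (b2 p1) g2.
have i2 := Lfun2_mul_integrable (b2 p2) g2.
have iq := Lfun2_mul_integrable (step_comb_Lfun2 qin) g2.
have i21 : mu.-integrable setT (EFin \o (fun x => b p.2.2 x * g x - b p.2.1 x * g x)).
  by have := integrableB measurableT i2 i1; apply: eq_integrable.
have ip : mu.-integrable setT (EFin \o (fun x => p.1 * (b p.2.2 x * g x - b p.2.1 x * g x))).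
  by have := integrableZl measurableT p.1 i21; apply: eq_integrable.
rewrite -RintegralB// -RintegralZl// -RintegralD//.
by apply: eq_Rintegral => x _; rewrite /step_comb big_cons; ring.
Qed.

End step_combinations.

(** By bilinearity, the inner products of step combinations are determined by the
Gram matrix of the family b; proportional Gram matrices give proportional inner
products. *)
Lemma step_comb_gram d1 d2 (T1 : measurableType d1) (T2 : measurableType d2)
    (R : realType) (mu1 : {measure set T1 -> \bar R})
    (mu2 : {measure set T2 -> \bar R}) (t c : R)
    (b1 : R -> T1 -> R) (b2 : R -> T2 -> R) (q q' : seq (R * (R * R))) :
  (forall s, 0 <= s <= t -> b1 s \in Lfun mu1 2%:E) ->
  (forall s, 0 <= s <= t -> b2 s \in Lfun mu2 2%:E) ->
  (forall r s, 0 <= r <= t -> 0 <= s <= t ->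
    \int[mu1]_x (b1 r x * b1 s x) = c * \int[mu2]_x (b2 r x * b2 s x)) ->
  step_in t q -> step_in t q' ->
  \int[mu1]_x (step_comb b1 q x * step_comb b1 q' x) =
  c * \int[mu2]_x (step_comb b2 q x * step_comb b2 q' x).
Proof.
move=> L1 L2 gram qt q't.
have gram1 s : 0 <= s <= t ->
    \int[mu1]_x (b1 s x * step_comb b1 q' x) = c * \int[mu2]_x (b2 s x * step_comb b2 q' x).
  move=> st; under eq_Rintegral => x _ do rewrite mulrC.
  under [in RHS]eq_Rintegral => x _ do rewrite mulrC.
  rewrite (step_comb_inner L1)//; last exact: L1.
  rewrite (step_comb_inner L2)//; last exact: L2.
  rewrite mulr_sumr; elim: q' q't => [|p q' ih]; first by rewrite !big_nil.
  move=> /step_in_cons[p1 p2 _ /ih {}ih]; rewrite !big_cons ih; congr (_ + _).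
  by rewrite !gram// -mulrBr mulrCA.
rewrite (step_comb_inner L1)//; last exact: (step_comb_Lfun2 L1).
rewrite (step_comb_inner L2)//; last exact: (step_comb_Lfun2 L2).
rewrite mulr_sumr; elim: q qt => [|p q ih]; first by rewrite !big_nil.
move=> /step_in_cons[p1 p2 _ /ih {}ih]; rewrite !big_cons ih; congr (_ + _).
by rewrite !gram1// -mulrBr mulrCA.
Qed.

Lemma patchB (T : Type) (R : realType) (D : set T) (f g : T -> R) :
  (f \- g) \_ D = f \_ D \- g \_ D.
Proof. by apply/funext => x; rewrite /= !patchE; case: ifPn => // _; rewrite subrr. Qed.

Lemma patchM (T : Type) (R : realType) (D : set T) (f g : T -> R) :
  (fun x => f x * g x) \_ D = (fun x => (f \_ D) x * (g \_ D) x).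
Proof. by apply/funext => x; rewrite /= !patchE; case: ifPn => // _; rewrite mul0r. Qed.

Lemma inner_patch d (T : measurableType d) (R : realType)
    (mu : {measure set T -> \bar R}) (D : set T) (f g : T -> R) :
  inner mu D f g = \int[mu]_x ((f \_ D) x * (g \_ D) x).
Proof. by rewrite /inner Rintegral_mkcond patchM. Qed.

Section wiener.
Context d (Omega : measurableType d) (R : realType).
Variables (P : probability Omega R) (W : R -> {RV P >-> R}) (T : R).
Hypothesis HW : wiener_process W.
Local Notation mu := (@lebesgue_measure R).

Let B (s : R) (w : Omega) : R := W s w - W 0 w.

Let ind (s : R) : R -> R := (\1_(`]0, s]%classic) : R -> R) \_ `]0, T[.

Let mW s t : measurable_fun setT (fun w => W t w - W s w).
Proof. exact: measurable_funB. Qed.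

Let increment (s t : R) : 0 <= s -> s <= t ->
  [/\ (fun w => W t w - W s w) \in Lfun P 2%:E,
    \int[P]_w (W t w - W s w) = 0 &
    \int[P]_w ((W t w - W s w) * (W t w - W s w)) = normal_moment2 * (t - s)].
Proof.
move=> s0; rewrite le_eqVlt => /predU1P[<-|st].
  have z : (fun w => W s w - W s w) = cst 0 by apply/funext => w; rewrite subrr.
  split; first by rewrite z Lfun_cst.
    by under eq_Rintegral => w _ do rewrite subrr; rewrite Rintegral_cst// mul0r.
  under eq_Rintegral => w _ do rewrite subrr mulr0.
  by rewrite Rintegral_cst// mul0r subrr mulr0.
have ts0 : 0 < Num.sqrt (t - s) by rewrite sqrtr_gt0 subr_gt0.
have [_ _ N _] := HW; have {}N := N s t s0 st.
split; first exact: gaussian_Lfun2 (mW s t) ts0 N.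
  exact: gaussian_mean (mW s t) ts0 N.
by rewrite (gaussian_second_moment (mW s t) ts0 N) sqr_sqrtr// subr_ge0 ltW.
Qed.

Let B2 s : 0 <= s -> B s \in Lfun P 2%:E.
Proof. by move=> s0; have [] := increment (lexx 0) s0. Qed.

(** The covariances come from the variances of three increments, by polarization. *)
Let B_gram r s : 0 <= r -> 0 <= s ->
  \int[P]_w (B r w * B s w) = normal_moment2 * Num.min r s.
Proof.
wlog rs : r s / r <= s => [H r0 s0|r0 s0].
  have [rs|/ltW sr] := leP r s; first by rewrite H// min_l.
  by under eq_Rintegral => w _ do rewrite mulrC; rewrite H// min_l.
rewrite min_l//.
have [_ _ Er] := increment (lexx 0) r0; have [_ _ Es] := increment (lexx 0) s0.
have [L _ Ers] := increment r0 rs; rewrite !subr0 in Er Es.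
have ir := Lfun2_mul_integrable (B2 r0) (B2 r0).
have is_ := Lfun2_mul_integrable (B2 s0) (B2 s0).
have irs := Lfun2_mul_integrable (B2 r0) (B2 s0).
have i1 : P.-integrable setT (EFin \o (fun w => B r w * B r w + B s w * B s w)).
  by have := integrableD measurableT ir is_; apply: eq_integrable.
have i2 : P.-integrable setT (EFin \o (fun w => 2 * (B r w * B s w))).
  by have := integrableZl measurableT 2 irs; apply: eq_integrable.
have : \int[P]_w ((W s w - W r w) * (W s w - W r w)) =
   \int[P]_w (B r w * B r w) + \int[P]_w (B s w * B s w) - 2 * \int[P]_w (B r w * B s w).
  rewrite -RintegralD// -RintegralZl// -RintegralB//.
  by apply: eq_Rintegral => w _; rewrite /B; ring.
rewrite Ers [X in _ = X + _ - _]Er [X in _ = _ + X - _]Es; lra.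
Qed.

Let indE s : ind s = \1_(`]0, T[ `&` `]0, s]).
Proof.
apply/funext => x; rewrite /ind patchE [RHS]indicE in_setI !mem_setE.
by case: ifPn => _ //=; rewrite indicE mem_setE.
Qed.

Let indM r s x : ind r x * ind s x = \1_(`]0, T[ `&` `]0, Num.min r s]) x.
Proof.
rewrite !indE !indicE !in_setI !mem_setE !in_itv/= le_min.
by case: (0 < x) => //=; case: (x < T); case: (x <= r); case: (x <= s);
  rewrite ?mulr1 ?mulr0 ?mul0r.
Qed.

Let ind2 s : ind s \in Lfun mu 2%:E.
Proof.
have mA : measurable (`]0, T[ `&` `]0, s] : set R) by exact: measurableI.
rewrite inE; apply/andP; split; rewrite inE/=; first by rewrite indE; exact: measurable_indic.
rewrite /finite_norm; apply: (@lty_poweRy _ _ 2); first by rewrite pnatr_eq0.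
rewrite powR_Lnorm ?pnatr_eq0//.
under eq_integral => x _ do
  rewrite /= powR_mulrn// real_normK ?num_real// expr2 indM minxx.
rewrite integral_indic// setIT.
apply: (@le_lt_trans _ _ (mu `]0, T[)); first by apply: le_measure; rewrite ?inE.
by rewrite lebesgue_measure_itv/=; case: ifPn => _; rewrite ltry.
Qed.

Let ind_gram r s : 0 <= r <= T -> 0 <= s <= T ->
  \int[mu]_x (ind r x * ind s x) = Num.min r s.
Proof.
move=> /andP[r0 rT] /andP[s0 sT]; set m := Num.min r s.
have m0 : 0 <= m by rewrite le_min r0.
have mT : m <= T by rewrite ge_min rT.
have itvE b : mu [set` Interval (BRight 0) (BSide b m)] = m%:E.
  rewrite lebesgue_measure_itv/= lte_fin; case: ltP => [_|mle0].
    by rewrite -EFinD subr0.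
  by congr EFin; apply/eqP; rewrite eq_le m0.
under eq_Rintegral => x _ do rewrite indM.
rewrite /Rintegral integral_indic//; last exact: measurableI.
rewrite setIT -/m; move: mT; rewrite le_eqVlt => /predU1P[mT|mT].
  rewrite -mT (_ : _ `&` _ = [set` `]0, m[%R]); last first.
    by apply/seteqP; split => x /=; rewrite !in_itv/=;
      [case|move=> /andP[-> xm]; rewrite xm ltW].
  exact: (congr1 fine (itvE true)).
rewrite (_ : _ `&` _ = [set` `]0, m]%R]); last first.
  apply/seteqP; split => x /=; rewrite !in_itv/=; first by case.
  by move=> /andP[-> xm]; rewrite xm (le_lt_trans xm).
exact: (congr1 fine (itvE false)).
Qed.

Let step_wienerE q : step_wiener W q = step_comb B q.
Proof.
apply/funext => w; rewrite /step_wiener /step_comb; apply: eq_bigr => p _.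
by congr (_ * _); rewrite /B; ring.
Qed.

Let step_funE q : step_in T q -> step_fun q \_ `]0, T[ = step_comb ind q.
Proof.
move=> qT; apply/funext => x; rewrite patchE /step_comb /step_fun.
case: ifPn => xT; last first.
  by rewrite big1// => p _; rewrite /ind !patchE (negbTE xT) subrr mulr0.
elim: q qT => [|p q ih]; first by rewrite !big_nil.
move=> /step_in_cons[/andP[p1 _] p2 p12 /ih {}ih]; rewrite !big_cons ih; congr (_ * _ + _).
rewrite /ind !patchE xT !indicE !mem_setE !in_itv/=.
move: xT; rewrite mem_setE in_itv/= => /andP[x0 _]; rewrite x0/=.
have [x1|x1] := leP x p.2.1; first by rewrite (le_trans x1 p12) subrr.
by rewrite subr0.
Qed.

Let B2T s : 0 <= s <= T -> B s \in Lfun P 2%:E.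
Proof. by move=> /andP[s0 _]; exact: B2. Qed.

Let ind2T s : 0 <= s <= T -> ind s \in Lfun mu 2%:E.
Proof. by move=> _; exact: ind2. Qed.

Lemma wiener_integral_Lfun2 F J : wiener_integral W T F J -> J \in Lfun P 2%:E.
Proof. by move=> [_ J2 _]; move: J2; rewrite /L2 patch_setT. Qed.

Lemma wiener_integral_mean F J : wiener_integral W T F J -> \int[P]_w J w = 0.
Proof.
move=> HJ; have J2 := wiener_integral_Lfun2 HJ; have [_ _ [q [qT _ qJ]]] := HJ.
have one2 : cst 1 \in Lfun P 2%:E by exact: Lfun_cst.
have S2 k : step_comb B (q k) \in Lfun P 2%:E := step_comb_Lfun2 B2T (qT k).
have c1 : ('N[P]_2%:E [EFin \o (step_comb B (q k) \- J)%R])%E @[k --> \oo] --> 0%E.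
  apply: cvg_trans qJ; apply: near_eq_cvg; apply: nearW => k.
  by rewrite patch_setT step_wienerE.
have c2 : ('N[P]_2%:E [EFin \o (cst 1 \- cst 1)%R])%E @[k --> \oo] --> (0%E : \bar R).
  rewrite (_ : EFin \o _ = cst 0%E); last by apply/funext => w /=; rewrite subrr.
  by rewrite Lnorm0//; exact: cvg_cst.
have := cvg_Lfun2_mul S2 J2 (fun=> one2) one2 c1 c2.
have -> : (fun k => \int[P]_w (step_comb B (q k) w * cst 1 w)) = cst 0.
  apply/funext => k; rewrite (step_comb_inner B2T)//.
  have qk := qT k; elim: (q k) qk => [|p s ih]; first by rewrite big_nil.
  move=> /step_in_cons[/andP[p1 _] /andP[p2 _] _ /ih]; rewrite big_cons => ->.
  under eq_Rintegral => w _ do rewrite mulr1.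
  under [X in _ - X]eq_Rintegral => w _ do rewrite mulr1.
  have [_ -> _] := increment (lexx 0) p1; have [_ -> _] := increment (lexx 0) p2.
  by rewrite subrr mulr0 addr0.
move=> /(cvg_unique _ (cvg_cst _)) ->//.
by apply: eq_Rintegral => w _; rewrite mulr1.
Qed.

(** The Ito isometry in polarized form.  The families W_s - W_0 and 1_]0, s] have
Gram matrices v min(r, s) and min(r, s), which settles the case of step
functions; both sides are continuous in L^2. *)
Lemma wiener_integral_inner F J F' J' :
  wiener_integral W T F J -> wiener_integral W T F' J' ->
  \int[P]_w (J w * J' w) = normal_moment2 * inner mu `]0, T[ F F'.
Proof.
move=> HJ HJ'; rewrite inner_patch.
have J2 := wiener_integral_Lfun2 HJ; have J'2 := wiener_integral_Lfun2 HJ'.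
have [F2 _ [q [qT qF qJ]]] := HJ; have [F'2 _ [q' [q'T q'F' q'J']]] := HJ'.
have S2 k := step_comb_Lfun2 B2T (qT k); have S'2 k := step_comb_Lfun2 B2T (q'T k).
have I2 k := step_comb_Lfun2 ind2T (qT k); have I'2 k := step_comb_Lfun2 ind2T (q'T k).
have cvgW G L : L2_cvg P setT (fun k => step_wiener W (G k)) L ->
    ('N[P]_2%:E [EFin \o (step_comb B (G k) \- L)%R])%E @[k --> \oo] --> 0%E.
  move=> H; apply: cvg_trans H; apply: near_eq_cvg; apply: nearW => k.
  by rewrite patch_setT step_wienerE.
have cvgI G L : (forall k, step_in T (G k)) ->
    L2_cvg mu `]0, T[ (fun k => step_fun (G k)) L ->
    ('N[mu]_2%:E [EFin \o (step_comb ind (G k) \- (L \_ `]0, T[))%R])%E @[k --> \oo] --> 0%E.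
  move=> GT H; apply: cvg_trans H; apply: near_eq_cvg; apply: nearW => k.
  by rewrite patchB step_funE.
have l1 := cvg_Lfun2_mul S2 J2 S'2 J'2 (cvgW _ _ qJ) (cvgW _ _ q'J').
have l2 := cvg_Lfun2_mul I2 F2 I'2 F'2 (cvgI _ _ qT qF) (cvgI _ _ q'T q'F').
pose G k := \int[mu]_x (step_comb ind (q k) x * step_comb ind (q' k) x).
have E : (fun k => \int[P]_w (step_comb B (q k) w * step_comb B (q' k) w)) =
    (fun k => normal_moment2 * G k).
  apply/funext => k; apply: (step_comb_gram B2T ind2T _ (qT k) (q'T k)) => r s rT sT.
  by rewrite ind_gram// B_gram//; [case/andP: rT|case/andP: sT].
have l1' : (fun k => normal_moment2 * G k) @ \oo --> \int[P]_w (J w * J' w).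
  by rewrite -E; exact: l1.
have l2' : (fun k => normal_moment2 * G k) @ \oo -->
    normal_moment2 * \int[mu]_x ((F \_ `]0, T[) x * (F' \_ `]0, T[) x).
  by apply: cvgMl_tmp; exact: l2.
exact: (cvg_unique _ l1' l2').
Qed.

End wiener.

(** * Fourier coefficients of a random function *)

Lemma Rintegral_sum d (T : measurableType d) (R : realType)
    (mu : {measure set T -> \bar R}) (I : Type) (s : seq I) (f : I -> T -> R) :
  (forall i, mu.-integrable setT (EFin \o f i)) ->
  \int[mu]_x (\sum_(i <- s) f i x) = \sum_(i <- s) \int[mu]_x f i x.
Proof.
move=> fi; elim: s => [|i s ih].
  under eq_Rintegral => x _ do rewrite big_nil.
  by rewrite big_nil Rintegral_cst// mul0r.
under eq_Rintegral => x _ do rewrite big_cons.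
rewrite big_cons RintegralD// ?ih//.
rewrite (_ : EFin \o _ = fun x => (\sum_(j <- s) (f j x)%:E)%E).
  by apply: integrable_sum => // j _; exact: fi.
by apply/funext => x /=; rewrite sumEFin.
Qed.

Section orthonormal_expansion.
Context d1 d2 (Omega : measurableType d1) (X : measurableType d2) (R : realType).
Variables (P : probability Omega R) (mu : {sigma_finite_measure set X -> \bar R}).
Variables (e : nat -> X -> R) (a : nat -> Omega -> R) (U : Omega * X -> R).
Hypotheses (e2 : forall k, e k \in Lfun mu 2%:E)
  (e_orthonormal : forall k l, \int[mu]_x (e k x * e l x) = (k == l)%:R)
  (ma : forall k, measurable_fun setT (a k))
  (U2 : U \in Lfun (P \x mu)%E 2%:E).
Let S N (p : Omega * X) : R := \sum_(k < N) a k p.1 * e k p.2.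
Hypothesis SU : ('N[(P \x mu)%E]_2%:E [EFin \o (S N \- U)%R])%E @[N --> \oo] --> 0%E.

Let coef k w := \int[mu]_x (U (w, x) * e k x).

Let me k : measurable_fun setT (e k). Proof. exact: Lfun_measurable (e2 k). Qed.

Let mU : measurable_fun setT U. Proof. exact: Lfun_measurable U2. Qed.

Let mS N : measurable_fun setT (S N).
Proof.
apply: measurable_sum => k; apply: measurable_funM.
  exact: (measurableT_comp (ma k) measurable_fst).
exact: (measurableT_comp (me k) measurable_snd).
Qed.

Let Ue_integrable k : (P \x mu)%E.-integrable setT (fun p => (U p * e k p.2)%:E).
Proof.
have ek2 : (fun p : Omega * X => e k p.2) \in Lfun (P \x mu)%E 2%:E.
  have m2 : measurable_fun setT (fun p : Omega * X => e k p.2).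
    exact: (measurableT_comp (me k) measurable_snd).
  rewrite inE; apply/andP; split; rewrite inE//=.
  rewrite /finite_norm; apply: (@lty_poweRy _ _ 2); first by rewrite pnatr_eq0.
  rewrite powR_Lnorm ?pnatr_eq0//.
  under eq_integral => p _ do rewrite /= powR_mulrn// real_normK ?num_real//.
  rewrite (@fubini_tonelli1 _ _ _ _ R P mu (fun p => (e k p.2 ^+ 2)%:E))//=.
  - rewrite /fubini_F/= integral_cst//= probability_setT mule1.
    have /integrableP[_] := Lfun2_integrable_sqr (e2 k).
    by under eq_integral => x _ do rewrite /= ger0_norm ?sqr_ge0//.
  - by apply/measurable_EFinP; exact: measurable_funX.
  - by move=> p; rewrite lee_fin sqr_ge0.
exact: Lfun2_mul_integrable U2 ek2.
Qed.

(** Fubini, the integrand being integrable as a product of two functions in L^2. *)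
Lemma measurable_coef k : measurable_fun setT (coef k).
Proof.
apply: (measurableT_comp (@fine_measurable _ setT measurableT)) => //.
exact: measurable_fubini_F (Ue_integrable k).
Qed.

(** For k < N, orthonormality makes coef k w - a k w the k-th coefficient of the
remainder U - S N on the slice at w, and Cauchy-Schwarz bounds it by the norm of
the remainder.  The bound is trivial on slices where this norm is infinite. *)
Let slice_bound k N w : (k < N)%N ->
  (((coef k w - a k w) ^+ 2)%:E <= \int[mu]_x ((S N (w, x) - U (w, x)) ^+ 2)%:E)%E.
Proof.
move=> kN; pose V x := S N (w, x) - U (w, x).
have mV : measurable_fun setT V.
  by apply: measurable_funB; apply: measurableT_comp.
have [Voo|] := ltP (\int[mu]_x (V x ^+ 2)%:E)%E +oo%E; last first.
  by rewrite leye_eq => /eqP ->; exact: leey.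
have V2 : V \in Lfun mu 2%:E.
  rewrite inE; apply/andP; split; rewrite inE//=.
  rewrite /finite_norm; apply: (@lty_poweRy _ _ 2); first by rewrite pnatr_eq0.
  rewrite powR_Lnorm ?pnatr_eq0//.
  by under eq_integral => p _ do rewrite /= powR_mulrn// real_normK ?num_real//.
pose Sw x := S N (w, x).
have Sw2 : Sw \in Lfun mu 2%:E.
  rewrite (_ : Sw = \sum_(i < N) (a i w \o* e i : X -> R)).
    apply: rpred_sum => [|? i _ /=]; first by rewrite lee1n.
    by apply: Lfun_scale; rewrite ?ler1n.
  apply/funext => x; rewrite /Sw /S/= fct_sumE; apply: eq_bigr => i _.
  by rewrite mulrC.
have Uw2 : (fun x => U (w, x)) \in Lfun mu 2%:E.
  rewrite (_ : (fun x => _) = Sw \- V); first exact: Lfun2B.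
  by apply/funext => x; rewrite /V/= opprB addrCA subrr addr0.
have Se : \int[mu]_x (Sw x * e k x) = a k w.
  under eq_Rintegral => x _ do rewrite /Sw /S/= mulr_suml.
  rewrite Rintegral_sum => [|i]; last first.
    have := integrableZl measurableT (a i w) (Lfun2_mul_integrable (e2 i) (e2 k)).
    by apply: eq_integrable => // x _ /=; rewrite -mulrA EFinM.
  rewrite (bigD1 (Ordinal kN))//= big1 ?addr0 => [|i ik].
    under eq_Rintegral => x _ do rewrite -mulrA.
    by rewrite RintegralZl ?e_orthonormal ?eqxx ?mulr1//; exact: Lfun2_mul_integrable.
  under eq_Rintegral => x _ do rewrite -mulrA.
  rewrite RintegralZl ?e_orthonormal//; last exact: Lfun2_mul_integrable.
  by rewrite (_ : _ == _ = false) ?mulr0//; apply: contra_neqF ik => /eqP ik; exact/val_inj.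
have -> : coef k w - a k w = - \int[mu]_x (V x * e k x).
  rewrite -Se -[RHS]mulN1r -RintegralZl//; last exact: Lfun2_mul_integrable.
  rewrite /coef -RintegralB//; [|exact: Lfun2_mul_integrable..].
  by apply: eq_Rintegral => x _; rewrite /V /Sw; ring.
rewrite sqrrN -real_normK ?num_real//.
have ek1 : ('N[mu]_2%:E [EFin \o e k] = 1)%E.
  have : fine ('N[mu]_2%:E [EFin \o e k])%E ^+ 2 = 1.
    rewrite expr2 -fineM ?Lfun2_fin// Lnorm2_sqr.
    under eq_integral => x _ do rewrite expr2.
    by rewrite -[LHS]/(\int[mu]_x (e k x * e k x)) e_orthonormal eqxx.
  move=> /eqP; rewrite sqrf_eq1 => /orP[] /eqP ek1.
    by rewrite -(fineK (Lfun2_fin (e2 k))) ek1.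
  have : 0 <= fine ('N[mu]_2%:E [EFin \o e k])%E by rewrite fine_ge0// Lnorm_ge0.
  by rewrite ek1 oppr_ge0 ler10.
have := cauchy_schwarz_Rintegral V2 (e2 k); rewrite ek1 mulr1 => H.
rewrite -Lnorm2_sqr -[X in (X * X)%E]fineK ?Lfun2_fin// -EFinM lee_fin -expr2.
by rewrite lerXn2r ?nnegrE// fine_ge0// Lnorm_ge0.
Qed.

(** Integrated over w, [slice_bound] bounds the mean square of coef k - a k by the
squared norm of the remainder, for every N > k. *)
Lemma coef_ae k : {ae P, forall w, coef k w = a k w}.
Proof.
have mca : measurable_fun setT (coef k \- a k).
  by apply: measurable_funB => //; exact: measurable_coef.
suff : 'N[P]_2%:E [EFin \o (coef k \- a k)%R]%E = 0%E.
  by move=> /(Lnorm2_eq0 mca); apply: filterS => w /eqP; rewrite subr_eq0 => /eqP.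
suff : ('N[P]_2%:E [EFin \o (coef k \- a k)%R] * 'N[P]_2%:E [EFin \o (coef k \- a k)%R] = 0)%E.
  by move=> /eqP; rewrite mule_eq0 => /orP[] /eqP.
rewrite Lnorm2_sqr; apply/eqP; rewrite eq_le integral_ge0 ?andbT; last first.
  by move=> w _; rewrite lee_fin sqr_ge0.
have SU2 : ('N[(P \x mu)%E]_2%:E [EFin \o (S N \- U)%R] *
    'N[(P \x mu)%E]_2%:E [EFin \o (S N \- U)%R])%E @[N --> \oo] --> 0%E.
  by rewrite -(mule0 0%E); apply: cvgeM => //.
rewrite -(cvg_lim _ SU2)//; apply: lime_ge; first by apply/cvg_ex; eexists; exact: SU2.
near=> N; have kN : (k < N)%N by near: N; exact: nbhs_infty_gt.
have mSU : measurable_fun setT (fun p => ((S N \- U)%R p ^+ 2)%:E).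
  by apply/measurable_EFinP; apply: measurable_funX; exact: measurable_funB.
rewrite Lnorm2_sqr (@fubini_tonelli1 _ _ _ _ R P mu _ mSU); last first.
  by move=> p; rewrite lee_fin sqr_ge0.
apply: ge0_le_integral => //=.
- by move=> w _; rewrite lee_fin sqr_ge0.
- by apply/measurable_EFinP; exact: measurable_funX.
- apply: measurable_fun_fubini_tonelli_F => // p.
  by rewrite lee_fin sqr_ge0.
- by move=> w _; exact: slice_bound.
Unshelve. all: by end_near. Qed.

End orthonormal_expansion.

(** * Moments of the coefficients of a mild solution *)

Section almost_everywhere_moments.
Context d (Omega : measurableType d) (R : realType) (P : probability Omega R).
Implicit Types X Y J : Omega -> R.

Lemma ae_eq_expectation X Y : measurable_fun setT X -> measurable_fun setT Y ->
  {ae P, forall w, X w = Y w} -> ('E_P[X] = 'E_P[Y])%E.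
Proof.
move=> mX mY XY; rewrite unlock; apply: ae_eq_integral => //.
- exact/measurable_EFinP.
- exact/measurable_EFinP.
- by apply: filterS XY => w -> _.
Qed.

Lemma ae_eq_covariance X Y X' Y' :
  measurable_fun setT X -> measurable_fun setT Y ->
  measurable_fun setT X' -> measurable_fun setT Y' ->
  {ae P, forall w, X w = X' w} -> {ae P, forall w, Y w = Y' w} ->
  covariance P X Y = covariance P X' Y'.
Proof.
move=> mX mY mX' mY' XX' YY'; rewrite unlock.
rewrite (ae_eq_expectation mX mX' XX') (ae_eq_expectation mY mY' YY').
apply: ae_eq_expectation.
- by apply: measurable_funM; apply: measurable_funB.
- by apply: measurable_funM; apply: measurable_funB.
- by move: XX' YY'; apply: filterS2 => w Xw Yw; rewrite !fctE/= Xw Yw.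
Qed.

Lemma integrable_Lfun2 J : J \in Lfun P 2%:E -> P.-integrable setT (EFin \o J).
Proof.
by move=> J2; apply/Lfun1_integrable; apply: Lfun_subset12 => //; exact: fin_num_measure.
Qed.

Lemma expectation_affine (m g : R) J : J \in Lfun P 2%:E -> \int[P]_w J w = 0 ->
  ('E_P[fun w => (m + g * J w)%R] = m%:E)%E.
Proof.
move=> J2 J0; have J1 := integrable_Lfun2 J2; rewrite unlock.
have gJ : P.-integrable setT (fun w => (g * J w)%:E).
  by have := integrableZl measurableT g J1; apply: eq_integrable.
under eq_integral => w _ do rewrite EFinD.
rewrite integralD//; last exact: finite_measure_integrable_cst.
rewrite integral_cst//= probability_setT mule1.
under eq_integral => w _ do rewrite EFinM.
rewrite integralZl//.
have -> : (\int[P]_w (J w)%:E = (\int[P]_w J w)%:E)%E.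
  by rewrite fineK//; exact: integrable_fin_num.
by rewrite J0 mule0 adde0.
Qed.

Lemma covariance_affine (m g m' g' : R) J J' :
  J \in Lfun P 2%:E -> J' \in Lfun P 2%:E ->
  \int[P]_w J w = 0 -> \int[P]_w J' w = 0 ->
  covariance P (fun w => m + g * J w) (fun w => m' + g' * J' w) =
  (g * g' * \int[P]_w (J w * J' w))%:E.
Proof.
move=> J2 J'2 J0 J'0; rewrite unlock !expectation_affine//=.
have -> : ((fun w => m + g * J w) \- cst m) * ((fun w => m' + g' * J' w) \- cst m') =
    (fun w => g * g' * (J w * J' w)).
  by apply/funext => w; rewrite !fctE/=; ring.
rewrite unlock.
under eq_integral => w _ do rewrite EFinM.
have JJ' := Lfun2_mul_integrable J2 J'2.
rewrite integralZl// [RHS]EFinM; congr (_ * _)%E.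
by rewrite fineK//; exact: integrable_fin_num.
Qed.

End almost_everywhere_moments.

Section interval_integrals.
Context {R : realType}.
Local Notation mu := (@lebesgue_measure R).
Variable T : R.
Hypothesis T0 : 0 < T.

Lemma integrable_itv_Lfun2 (F G : R -> R) :
  L2 mu `]0, T[ F -> L2 mu `]0, T[ G ->
  mu.-integrable `]0, T[ (EFin \o (fun t => F t * G t)).
Proof.
move=> F2 G2; apply/(integrable_mkcond _ _).2 => //.
have := Lfun2_mul_integrable F2 G2; apply: eq_integrable => // t _ /=.
by rewrite !patchE; case: ifPn => // _; rewrite mul0r.
Qed.

Lemma L2_itv_cst1 : L2 mu `]0, T[ (cst 1).
Proof.
rewrite /L2 inE; apply/andP; split; rewrite inE/=.
  by apply: (iffLR (measurable_restrictT _ (measurable_itv _))); exact: measurable_cst.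
rewrite /finite_norm; apply: (@lty_poweRy _ _ 2); first by rewrite pnatr_eq0.
rewrite powR_Lnorm ?pnatr_eq0//.
apply: (@le_lt_trans _ _ (\int[mu]_x (EFin \o (cst (1%R : R) \_ `]0%R, T[)) x)%E).
  rewrite le_eqVlt; apply/orP; left; apply/eqP; apply: eq_integral => x _.
  rewrite /= patchE; case: ifPn => _; first by rewrite normr1 powR1.
  by rewrite normr0 powR0// pnatr_eq0.
rewrite -restrict_EFin -integral_mkcond (eq_integral (cst 1%E))//
  integral_cst//= mul1e lebesgue_measure_itv/=.
by case: ifPn => _; rewrite ltry.
Qed.

Lemma Rintegral_itv_gt0 (F : R -> R) : mu.-integrable `]0, T[ (EFin \o F) ->
  {ae mu, forall t, t \in `]0, T[ -> 0 < F t} ->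
  0 < \int[mu]_(t in `]0, T[) F t.
Proof.
move=> iF F0; have ae_mu : Filter (nbhs (almost_everywhere mu)).
  exact: ae_filter_ringOfSetsType.
have mF := measurable_int mu iF.
have abs : (\int[mu]_(t in `]0%R, T[) `|(F t)%:E| = \int[mu]_(t in `]0%R, T[) (F t)%:E)%E.
  apply: ae_eq_integral => //; first exact: measurableT_comp.
  move: F0; apply: (@filterS _ _ ae_mu) => t Ft tT /=; rewrite gtr0_norm//; exact: Ft.
have ge0 : (0 <= \int[mu]_(t in `]0%R, T[) (F t)%:E)%E by rewrite -abs integral_ge0.
have finF : (\int[mu]_(t in `]0%R, T[) (F t)%:E \is a fin_num)%E by exact: integrable_fin_num.
apply: fine_gt0; rewrite lt_neqAle ge0 ltey_eq finF !andbT eq_sym; apply/eqP => z.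
have /(ae_eq_integral_abs mu _ mF) : (\int[mu]_(t in `]0%R, T[) `|(EFin \o F) t| = 0)%E.
  by rewrite abs.
move=> H; have {}H := H (measurable_itv _).
have : mu.-negligible `]0, T[.
  have : {ae mu, forall t, ~ (t \in `]0, T[)}.
    move: F0 H; apply: (@filterS2 _ _ ae_mu) => t F0 Fz tT.
    by have := F0 tT; have [->] := Fz tT; rewrite ltxx.
  by apply: negligibleS => t /= tT; apply.
move=> /negligibleP => /(_ (measurable_itv _)) muT.
have : mu `]0, T[%classic = 0%E by exact: muT.
have -> : mu `]0, T[%classic = T%:E.
  by rewrite lebesgue_measure_itv/= lte_fin T0 -EFinD subr0.
by case=> /eqP; rewrite gt_eqF.
Qed.

Lemma integrable_mul_Loo (F h : R -> R) : L2 mu `]0, T[ F ->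
  h \_ `]0, T[ \in Lfun mu +oo%E -> mu.-integrable `]0, T[ (EFin \o (fun t => F t * h t)).
Proof.
move=> F2; rewrite inE => /andP[/[!inE]/= mh].
rewrite /finite_norm unlock.
rewrite ifT; last first.
  apply: (@lt_le_trans _ _ (mu `]0, T[%classic)); last by apply: le_measure; rewrite ?inE.
  by rewrite lebesgue_measure_itv/= lte_fin T0 -EFinD subr0 lte_fin.
move=> /ess_sup_inf.ess_supr_bounded[M hM].
have iF : mu.-integrable `]0, T[ (EFin \o F).
  have := integrable_itv_Lfun2 F2 L2_itv_cst1.
  by apply: eq_integrable => // t _ /=; rewrite mulr1.
have mF : measurable_fun setT (F \_ `]0, T[) by exact: Lfun_measurable F2.
have mFh : measurable_fun setT (fun t => (F \_ `]0, T[) t * (h \_ `]0, T[) t).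
  exact: measurable_funM.
suff FhT : mu.-integrable setT (EFin \o (fun t => (F \_ `]0, T[) t * (h \_ `]0, T[) t)).
  apply/(integrable_mkcond _ _).2 => //; apply: eq_integrable FhT => // t _ /=.
  by rewrite !patchE; case: ifPn => // _; rewrite mul0r.
apply/integrableP; split; first exact/measurable_EFinP.
have iFT : mu.-integrable setT (EFin \o (F \_ `]0, T[)).
  rewrite -restrict_EFin; apply: (integrable_mkcond _ _).1 => //; exact: iF.
apply: (@le_lt_trans _ _ (\int[mu]_t (`|M|%:E * `|(F \_ `]0, T[) t|%:E))%E).
  apply: ae_ge0_le_integral => //.
  - by apply: measurableT_comp => //; exact/measurable_EFinP.
  - by apply: measurable_funeM; apply/measurable_EFinP; exact: measurableT_comp.
  have ae_mu : Filter (nbhs (almost_everywhere mu)) by exact: ae_filter_ringOfSetsType.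
  move: hM; apply: (@filterS _ _ ae_mu) => t /= hM _; rewrite lee_fin normrM mulrC ler_wpM2r//.
  by rewrite (le_trans hM)// ler_norm.
rewrite ge0_integralZl//=.
- have /integrableP[_ iFlt] := iFT.
  by rewrite lte_mul_pinfty// lee_fin normr_ge0.
- by apply/measurable_EFinP; exact: measurableT_comp.
Qed.

End interval_integrals.

(** The expansion of v is the constant sequence 0, so v has norm 0. *)
Lemma orthonormal_basis_eq0 (R : realType) (n : nat) (D : set 'rV[R]_n)
    (phi : nat -> 'rV[R]_n -> R) (v : 'rV[R]_n -> R) :
  orthonormal_basis D phi -> L2 (lebesgue_rV n) D v ->
  (forall k, inner (lebesgue_rV n) D v (phi k) = 0) ->
  v = cst 0 %[ae lebesgue_rV n in D].
Proof.
move=> [_ _ basis] v2 v0; have := basis _ v2.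
rewrite /L2_cvg; under eq_fun => N.
  rewrite (_ : ((fun x => \sum_(k < N) inner (lebesgue_rV n) D v (phi k) * phi k x) \- v) \_ D =
    \- (v \_ D)); last first.
    apply/funext => x; rewrite /= !patchE; case: ifPn => xD /=; last by rewrite oppr0.
    by rewrite big1 ?sub0r// => k _; rewrite v0 mul0r.
  over.
move=> /(cvg_unique _ (cvg_cst _)) => /(_ (@ereal_hausdorff R)) z.
have mv : measurable_fun setT (v \_ D) by exact: Lfun_measurable v2.
have /(Lnorm2_eq0 _) : 'N[lebesgue_rV n]_2%:E [EFin \o (\- (v \_ D))%R]%E = 0%E by [].
move=> /(_ (measurable_funN mv)); apply: filterS => x /eqP; rewrite oppr_eq0 => /eqP.
by rewrite patchE => + xD; rewrite mem_set.
Qed.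

Section mild_solution_moments.
Context (R : realType) (n : nat) (D : set 'rV[R]_n) (d : measure_display)
  (Omega : measurableType d) (P : probability Omega R) (W : R -> {RV P >-> R}).
Variables (lam : nat -> R) (phi : nat -> 'rV[R]_n -> R) (alpha T : R)
  (f g : 'rV[R]_n -> R) (h : R -> R) (u : R -> Omega -> 'rV[R]_n -> R).
Hypotheses (T0 : 0 < T) (phi_basis : orthonormal_basis D phi)
  (HW : wiener_process W) (u_mild : mild_solution W D lam phi alpha T f g h u).
Local Notation mu := (lebesgue_rV n).
Local Notation kernel k := (fun tau => ml_kernel alpha (lam k) (T - tau)).
Local Notation X := (coefficient D phi T u).

Lemma mild_solution_kernel_L2 k : L2 lebesgue_measure `]0, T[ (kernel k).
Proof.
have [J [HJ _]] := u_mild; have TT : 0 <= T <= T by rewrite lexx ltW.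
by have [] := HJ k T TT.
Qed.

(** The first two moments of the coefficients.  Everything is multiplied by the
indicator of D, so that integrals over D become integrals over the whole space. *)
Lemma mild_solution_moments :
  (forall k, 'E_P[X k] = (I1 D lam phi alpha f h k T)%:E)%E /\
  forall i j, covariance P (X i) (X j) =
    (inner mu D g (phi i) * inner mu D g (phi j) *
     (normal_moment2 * inner lebesgue_measure `]0, T[ (kernel i) (kernel j)))%:E.
Proof.
have [J [HJ Hu]] := u_mild; have TT : 0 <= T <= T by rewrite lexx ltW.
have {}HJ k := HJ k T TT; have [u2 uS] := Hu T TT.
have J2 k := wiener_integral_Lfun2 (HJ k).
have mJ k : measurable_fun setT (J k T) := Lfun_measurable (J2 k).
have [phi2 phi_on _] := phi_basis.
pose e k := phi k \_ D.
pose a k w := I1 D lam phi alpha f h k T + inner mu D g (phi k) * J k T w.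
pose U : Omega * 'rV[R]_n -> R := (fun p => u T p.1 p.2) \_ (setT `*` D).
have UE w x : U (w, x) = (u T w \_ D) x.
  rewrite /U !patchE; congr (if _ then _ else _).
  by apply/idP/idP; rewrite !inE/=; [case|].
have XE k w : X k w = \int[mu]_x (U (w, x) * e k x).
  rewrite /coefficient inner_patch; apply: eq_Rintegral => x _.
  by rewrite UE.
have e_on k l : \int[mu]_x (e k x * e l x) = (k == l)%:R.
  by rewrite -inner_patch.
have ma k : measurable_fun setT (a k).
  by apply: measurable_funD => //; apply: measurable_funM.
have SU : ('N[(P \x mu)%E]_2%:E [EFin \o ((fun p => \sum_(k < N) a k p.1 * e k p.2) \- U)%R])%E
    @[N --> \oo] --> 0%E.
  apply: cvg_trans uS; apply: near_eq_cvg; apply: nearW => N.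
  rewrite patchB; congr (Lnorm _ _ (EFin \o (_ \- _))).
  apply/funext => -[w x]; rewrite patchE.
  have -> : (w, x) \in setT `*` D = (x \in D).
    by apply/idP/idP; rewrite !inE/=; [case|].
  rewrite /a /e /I2 /=; case: ifPn => xD.
    by apply: eq_bigr => k _; rewrite patchE xD.
  by rewrite big1// => k _; rewrite patchE (negbTE xD) mulr0.
have mX k : measurable_fun setT (X k).
  rewrite (_ : X k = fun w => \int[mu]_x (U (w, x) * e k x)); last by apply/funext.
  exact: (measurable_coef phi2 u2 k).
have Xa k : {ae P, forall w, X k w = a k w}.
  have := coef_ae phi2 e_on ma u2 SU k.
  by apply: filterS => w; rewrite XE.
have Jmean k := wiener_integral_mean HW (HJ k).
split => [k|i j].
  by rewrite (ae_eq_expectation (mX k) (ma k) (Xa k)) expectation_affine.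
rewrite (ae_eq_covariance (mX i) (mX j) (ma i) (ma j) (Xa i) (Xa j)).
by rewrite covariance_affine// (wiener_integral_inner HW (HJ i) (HJ j)).
Qed.

End mild_solution_moments.

(** * Uniqueness *)

Section time_integrals.
Context (R : realType) (alpha T : R).
Hypotheses (alpha0 : 0 < alpha) (alpha1 : alpha < 1) (T0 : 0 < T).
Local Notation kernel lambda := (fun tau => ml_kernel alpha lambda (T - tau)).
Local Notation mu := (@lebesgue_measure R).

Lemma kernel_inner_gt0 lambda lambda' : 0 < lambda -> 0 < lambda' ->
  L2 mu `]0, T[ (kernel lambda) -> L2 mu `]0, T[ (kernel lambda') ->
  0 < inner mu `]0, T[ (kernel lambda) (kernel lambda').
Proof.
move=> l0 l'0 K2 K'2; apply: Rintegral_itv_gt0 => //.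
  exact: integrable_itv_Lfun2 K2 K'2.
apply: aeW => t; rewrite in_itv/= => /andP[_ tT].
by rewrite mulr_gt0// ml_kernel_gt0// subr_gt0.
Qed.

Lemma kernel_mul_gt0 lambda (h : R -> R) (ch : R) : 0 < lambda ->
  L2 mu `]0, T[ (kernel lambda) -> h \_ `]0, T[ \in Lfun mu +oo%E ->
  0 < ch -> {ae mu, forall t, t \in `]0, T[ -> ch <= h t} ->
  0 < \int[mu]_(tau in `]0, T[) (ml_kernel alpha lambda (T - tau) * h tau).
Proof.
move=> l0 K2 hoo ch0 hch; apply: Rintegral_itv_gt0 => //.
  exact: integrable_mul_Loo K2 hoo.
have ae_mu : Filter (nbhs (almost_everywhere mu)) by exact: ae_filter_ringOfSetsType.
move: hch; apply: (@filterS _ _ ae_mu) => t hch tT.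
move: (tT); rewrite in_itv/= => /andP[_ t_lt_T].
by rewrite mulr_gt0 ?ml_kernel_gt0 ?subr_gt0// (lt_le_trans ch0)// hch.
Qed.

End time_integrals.

Lemma inner_lincomb (R : realType) (n : nat) (D : set 'rV[R]_n)
    (s : R) (v v' e : 'rV[R]_n -> R) :
  L2 (lebesgue_rV n) D v -> L2 (lebesgue_rV n) D v' -> L2 (lebesgue_rV n) D e ->
  L2 (lebesgue_rV n) D (fun x => v x - s * v' x) /\
  inner (lebesgue_rV n) D (fun x => v x - s * v' x) e =
  inner (lebesgue_rV n) D v e - s * inner (lebesgue_rV n) D v' e.
Proof.
move=> v2 v'2 e2.
have E : (fun x => v x - s * v' x) \_ D = v \_ D \- (s \o* (v' \_ D) : 'rV[R]_n -> R).
  apply/funext => x; rewrite /= !patchE; case: ifPn => _; first by rewrite mulrC.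
  by rewrite mul0r subrr.
split.
  by rewrite /L2 E; apply: Lfun2B => //; apply: Lfun_scale => //; rewrite ler1n.
rewrite !inner_patch E -RintegralZl//; last exact: Lfun2_mul_integrable.
rewrite -RintegralB//; last 2 first.
- exact: Lfun2_mul_integrable.
- have := integrableZl measurableT s (Lfun2_mul_integrable v'2 e2).
  by apply: eq_integrable.
by apply: eq_Rintegral => x _ /=; ring.
Qed.

Lemma orthonormal_basis_proportional (R : realType) (n : nat) (D : set 'rV[R]_n)
    (phi : nat -> 'rV[R]_n -> R) (s : R) (v v' : 'rV[R]_n -> R) :
  orthonormal_basis D phi ->
  L2 (lebesgue_rV n) D v -> L2 (lebesgue_rV n) D v' ->
  (forall k, inner (lebesgue_rV n) D v (phi k) = s * inner (lebesgue_rV n) D v' (phi k)) ->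
  v = (fun x => s * v' x) %[ae lebesgue_rV n in D].
Proof.
move=> phi_basis v2 v'2 E; have [phi2 _ _] := phi_basis.
have w0 k : inner (lebesgue_rV n) D (fun x => v x - s * v' x) (phi k) = 0.
  by have [_ ->] := inner_lincomb s v2 v'2 (phi2 k); rewrite E subrr.
have [w2 _] := inner_lincomb s v2 v'2 (phi2 0%N).
have := orthonormal_basis_eq0 phi_basis w2 w0.
by apply: filterS => x + xD => /(_ xD) /eqP; rewrite subr_eq0 => /eqP.
Qed.

Theorem theorem4p3 (R : realType) (n : nat) (D : set 'rV[R]_n)
    (a : 'I_n -> 'I_n -> 'rV[R]_n -> R) (b : 'I_n -> 'rV[R]_n -> R)
    (c : 'rV[R]_n -> R) (lam : nat -> R) (phi : nat -> 'rV[R]_n -> R)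
    (d : measure_display) (Omega : measurableType d) (P : probability Omega R)
    (W : R -> {RV P >-> R}) (alpha T : R)
    (h : R -> R) (ch : R) (f g ft gt : 'rV[R]_n -> R)
    (u ut : R -> Omega -> 'rV[R]_n -> R) (N0 : nat) :
  (0 < n)%N -> open D -> bounded_set D ->
  1 / 2 < alpha < 1 -> 0 < T ->
  admissible_operator D a b c ->
  eigensystem D a b c lam phi ->
  wiener_process W ->
  h \_ `]0, T[ \in Lfun lebesgue_measure +oo%E ->
  0 < ch -> {ae lebesgue_measure, forall t, t \in `]0, T[ -> ch <= h t} ->
  L2 (lebesgue_rV n) D f -> L2 (lebesgue_rV n) D ft ->
  sobolev D 2 g -> sobolev D 2 gt ->
  ~ g = cst 0 %[ae lebesgue_rV n in D] ->
  ~ gt = cst 0 %[ae lebesgue_rV n in D] ->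
  inner (lebesgue_rV n) D g (phi N0) <> 0 ->
  mild_solution W D lam phi alpha T f g h u ->
  mild_solution W D lam phi alpha T ft gt h ut ->
  let X k := coefficient D phi T u k in
  let Xt k := coefficient D phi T ut k in
  (forall k, 'E_P[Xt k] = 'E_P[X k])%E ->
  ('V_P[Xt N0] = 'V_P[X N0])%E ->
  (forall k, covariance P (Xt N0) (Xt k) = covariance P (X N0) (X k)) ->
  ft = f %[ae lebesgue_rV n in D] /\
  (fun x => `|gt x|) = (fun x => `|g x|) %[ae lebesgue_rV n in D].
Proof.
move=> _ _ _ /andP[alpha_half alpha1] T0 _ [[lam0 lamS] _ _ phi_basis] HW hoo ch0 hch.
move=> f2 ft2 [g2 _] [gt2 _] _ _ gN0 mu_ mut X Xt EX _ CX.
have alpha0 : 0 < alpha by apply: le_lt_trans alpha_half; rewrite divr_ge0.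
have lam_gt0 k : 0 < lam k by elim: k => // k ih; exact: lt_le_trans (lamS k).
have K2 := mild_solution_kernel_L2 T0 mu_.
have [EXE CXE] := mild_solution_moments T0 phi_basis HW mu_.
have [EXtE CXtE] := mild_solution_moments T0 phi_basis HW mut.
split.
  have coef_f k : inner (lebesgue_rV n) D ft (phi k) = 1 * inner (lebesgue_rV n) D f (phi k).
    have := EX k; rewrite EXE EXtE => -[]; rewrite /I1 mul1r; apply: mulIf.
    by rewrite gt_eqF// (kernel_mul_gt0 alpha0 alpha1 T0 (lam_gt0 k) (K2 k) hoo ch0 hch).
  have := orthonormal_basis_proportional phi_basis ft2 f2 coef_f.
  by apply: filterS => x + xD => /(_ xD) ->; rewrite mul1r.
pose gk k := inner (lebesgue_rV n) D g (phi k).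
pose gtk k := inner (lebesgue_rV n) D gt (phi k).
have prod k : gtk N0 * gtk k = gk N0 * gk k.
  have := CX k; rewrite CXE CXtE => -[]; apply: mulIf.
  rewrite mulf_neq0// gt_eqF ?normal_moment2_gt0//.
  by apply: (kernel_inner_gt0 alpha0 alpha1 T0 (lam_gt0 _) (lam_gt0 _)); exact: K2.
have gN0' : gk N0 != 0 by exact/eqP.
have [s s1 sN0] : exists2 s : R, `|s| = 1 & gtk N0 = s * gk N0.
  have /eqP := prod N0; rewrite -!expr2 eqf_sqr => /orP[] /eqP ->.
    by exists 1; rewrite ?normr1 ?mul1r.
  by exists (-1); rewrite ?normrN1 ?mulN1r.
have s0 : s != 0 by rewrite -normr_eq0 s1 oner_neq0.
have ss : s * s = 1.
  by have := real_normK (num_real s); rewrite s1 expr1n expr2 => <-.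
have coef_g k : inner (lebesgue_rV n) D gt (phi k) = s * inner (lebesgue_rV n) D g (phi k).
  have := prod k; rewrite sN0 -/(gk k) -/(gtk k) => p.
  apply: (mulfI gN0'); apply: (mulfI s0).
  by rewrite mulrA p [gk N0 * (s * _)]mulrCA [RHS]mulrA ss mul1r.
have := orthonormal_basis_proportional phi_basis gt2 g2 coef_g.
by apply: filterS => x + xD => /(_ xD) ->; rewrite normrM s1 mul1r.
Qed.
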